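(* Let $n\geq 2$ be an integer and define $$K:=\sum_{\substack{q>2\\ q \text{ prime}}}\frac{\log{q}}{(q-1)^2}.$$ Then $0.533821< K < 0.533822$, and \begin{equation*}\begin{split} &-\frac{1}{2}\sqrt{n}\log{n}-4\sqrt{n}-\frac{7\sqrt{n}}{\log{n}}-\frac{5}{4}\log{n}+\frac{1}{2}\log{2}+\log{\sqrt{2\pi}}-K-\frac{13}{4}-\frac{1}{\log{n}}-\frac{\log{n}}{4\sqrt{n}}-\frac{1}{4\sqrt{n}}+\frac{1}{12n+1}\\ &\leq \log{G(n)} - \left[n\log{n} + n \left(\frac{3}{2}\log{2} -1 + K\right)\right]\\ &\leq \frac{1}{2}\sqrt{n}\log{n}+4\sqrt{n}+\frac{7\sqrt{n}}{\log{n}}+\frac{1}{2}\log{n}+3+\log{\sqrt{2\pi}}-\log{2}-0.1250281+\frac{1}{\log{n}}+\frac{1}{12n}. \end{split}\end{equation*}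
   Context: For a positive integer $n$, define $G(n)=\prod_{q} q^{r(q)}$, where the product runs over all primes $q\leq n+1$, and $$r(2)=\left\lfloor\frac{n}{2}\right\rfloor+\sum_{j=0}^\infty \left\lfloor\frac{n}{2^j}\right\rfloor,\qquad r(q)=\sum_{j=0}^{\infty}\left\lfloor\frac{n}{q^j(q-1)}\right\rfloor \text{ for odd primes } q.$$ (This equals $\gcd\{|\mathrm{GL}_n(\mathbb{Z}/N\mathbb{Z})| : N\geq 3\}$.) Here $\log$ denotes the natural logarithm. *)

(* Defs.v *)
(* Stdlib reals and Coquelicot series for the analytic part; MathComp's nat,
   primes and big operators for the arithmetic part. *)
From mathcomp Require Import all_boot classical_sets cardinality fsbigop.

Set Implicit Arguments.
Unset Strict Implicit.
Unset Printing Implicit Defensive.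

Local Open Scope nat_scope.

(* sum_{j >= 0} floor(n / (q^j (q - 1))), as a sum over all j : nat of a family
   that has finite support as soon as q >= 2 (see [floor_supp]). *)
Definition floor_sum (n q : nat) : nat :=
  \big[addn/0]_(j \in [set: nat]%classic) (n %/ (q ^ j * q.-1)).

Lemma floor_eq0 n q j : 1 < q -> n <= j -> n %/ (q ^ j * q.-1) = 0.
Proof.
move=> q1 nj; apply: divn_small; apply: leq_ltn_trans nj _.
apply: (leq_trans (ltn_expl j q1)).
by rewrite leq_pmulr // -ltnS prednK // ltnW.
Qed.

Lemma floor_supp n q : 1 < q ->
  finite_set [set j | n %/ (q ^ j * q.-1) <> 0]%classic.
Proof.
move=> q1; apply: (sub_finite_set _ (finite_II n)) => j /= hj.
by rewrite ltnNge; apply/negP => /(floor_eq0 q1).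
Qed.

Lemma floor_sumE n q : 1 < q ->
  floor_sum n q = \sum_(j < n) n %/ (q ^ j * q.-1).
Proof.
move=> q1; rewrite (fsbig_ord _ n (fun j => n %/ (q ^ j * q.-1))) /floor_sum.
symmetry; apply: fsbig_widen => //.
move=> j [_ /= /negP]; rewrite -leqNgt => nj; exact: floor_eq0.
Qed.

(* For q = 2 the factor q - 1 in [floor_sum] is 1. *)
Definition r (n q : nat) : nat :=
  if q == 2 then n %/ 2 + floor_sum n 2 else floor_sum n q.

Definition G (n : nat) : nat := \prod_(q < n.+2 | prime q) q ^ r n q.

Definition odd_prime (q : nat) : bool := prime q && (2 < q).

(* Required only here: both libraries disturb nat (Stdlib rebinds nat's [_ ^ _]
   and the key %N, Coquelicot declares another eqType structure on it). *)
From Stdlib Require Import Reals.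
From Coquelicot Require Import Coquelicot.

Local Open Scope R_scope.

(* [Series] is the limit of the partial sums; its value would be 0 if this
   series of nonnegative terms diverged. *)
Definition K : R :=
  Series (fun q : nat =>
    if odd_prime q then ln (INR q) / (INR q - 1) ^ 2 else 0).

(* Main.v *)
(** The idea is to compare [G n] with [n!].  Legendre's formula for [n!] gives
[ln (G n) = ln n! + (n + n/2) ln 2 + sum_q D_q ln q] over odd primes [q], where
[D_q] is the sum over [j] of [floor (n / (q^j (q-1))) - floor (n / q^(j+1))].
Without the floors [D_q] would be [n / (q-1)^2], which produces the term [n K].

- If [q (q-1) <= n], the error in [D_q] is at most the number of [j] with
  [q^j (q-1) <= n] (plus [1/(q-1)]).  That number is at most 2 once
  [q^2 (q-1) > n], so the total is [2 theta(sqrt n)] up to [O(n^(1/3) ln n)], and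
  [theta x <= x ln 4] by Erdos's argument.
- If [q (q-1) > n], then [D_q] is 0 or 1, and [D_q = 1] forces
  [q = floor (n/m) + 1] with [m = floor (n/(q-1)) <= sqrt n]; summing [ln q] over
  such [m] costs [sqrt n ln n / 2 + sqrt n].
- The tail of [K] beyond [sqrt n] is bounded by the sum over all odd integers.

For the numerical value of [K], write
[1/(q-1)^2 = 1/(q^2-1) + 2/(q^3-1) + O(1/q^4)].  The sums of [ln q / (q^s-1)] over
all primes equal [- zeta'(s) / zeta(s)], so only [zeta] and [zeta'] at 2 and 3 and a
rapidly convergent remainder have to be computed; this is done with fixed-point
integer arithmetic up to 400 and Hermite-Hadamard bounds for the tails. *)
Require Import Defs.
From HB Require Import structures.
From Stdlib Require Import Reals Lra Psatz.
From Coquelicot Require Import Coquelicot.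
From mathcomp Require Import all_boot zify.

Set Implicit Arguments.
Unset Strict Implicit.
Unset Printing Implicit Defensive.

Local Open Scope nat_scope.

(** * Erdos's bound on the primorial *)

(** Distinct primes are coprime, so their divisibilities combine by Gauss's lemma. *)
Lemma prod_primes_dvdn (s : seq nat) (N : nat) :
  uniq s -> all prime s -> all (fun p => p %| N) s -> \prod_(p <- s) p %| N.
Proof.
elim: s => [|p s IH] /=; first by rewrite big_nil dvd1n.
move=> /andP[ps us] /andP[pp pr] /andP[pN sN].
rewrite big_cons Gauss_dvd ?pN ?IH //.
rewrite big_seq; apply: (big_ind (fun x => coprime p x)).
- by rewrite coprimen1.
- by move=> x y cx cy; rewrite coprimeMr cx.
- move=> q qs; rewrite prime_coprime // dvdn_prime2 ?(allP pr q qs) //.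
  by apply: contra ps => /eqP ->.
Qed.

(** The expansion of [(1 + 1) ^ (2j + 1)] contains two equal middle coefficients. *)
Lemma bin_central_le (j : nat) : 'C(j.*2.+1, j) <= 4 ^ j.
Proof.
have h : 'C(j.*2.+1, j) + 'C(j.*2.+1, j.+1) <= 2 ^ j.*2.+1.
  rewrite -[2]/(1 + 1) expnDn.
  under eq_bigr do rewrite !exp1n !muln1.
  have lj : j < j.*2.+2 by lia.
  have lj1 : j.+1 < j.*2.+2 by lia.
  rewrite (bigD1 (Ordinal lj)) //= (bigD1 (Ordinal lj1)) /=; last first.
    by rewrite -val_eqE /=; lia.
  by rewrite addnA leq_addr.
have e : 'C(j.*2.+1, j.+1) = 'C(j.*2.+1, j).
  by rewrite -bin_sub; [congr 'C(_, _); lia | lia].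
rewrite e addnn -mul2n expnS leq_pmul2l // in h.
by apply: leq_trans h _; rewrite -mul2n expnM.
Qed.

Lemma prime_dvd_fact p m : prime p -> p %| m`! -> p <= m.
Proof.
move=> pp; elim: m => [|m IH].
  by rewrite fact0 dvdn1 => /eqP e; rewrite e in pp.
rewrite factS Euclid_dvdM // => /orP[/dvdn_leq|/IH]; lia.
Qed.

(** [p] divides [(2j + 1)!], which is the coefficient times [j! (j + 1)!], and [p] exceeds every
    factor of these two factorials. *)
Lemma prime_dvd_bin_central (j p : nat) :
  prime p -> j.+1 < p -> p <= j.*2.+1 -> p %| 'C(j.*2.+1, j).
Proof.
move=> pp h1 h2.
have := @bin_fact j.*2.+1 j; rewrite (_ : j.*2.+1 - j = j.+1); last lia.
move=> /(_ ltac:(lia)) e.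
have : p %| (j.*2.+1)`! by rewrite dvdn_fact // h2 prime_gt0.
rewrite -e Euclid_dvdM //; case/orP=> [//|]; rewrite Euclid_dvdM //; case/orP=> d;
  have := prime_dvd_fact pp d; lia.
Qed.

(** Strong induction, the product running over [p <= m + 1]. Beyond the base cases, an even last
    candidate drops out; if the last candidate is [2j + 1], the primes from [j + 2] on divide
    ['C(2j + 1, j)], and this part and the remaining one contribute at most [4 ^ j] each. *)
Lemma primorial_le (m : nat) : \prod_(0 <= p < m.+2 | prime p) p <= 4 ^ m.
Proof.
elim/ltn_ind: m => [[|[|m]]] IH.
- by rewrite unlock.
- by rewrite unlock.
have [om|em] := boolP (odd m).
  have np : prime m.+3 = false.
    apply/negbTE/negP => /even_prime [|]; lia.
  rewrite big_mkcond big_nat_recr //= np muln1 -big_mkcond.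
  by apply: leq_trans (IH m.+1 _) _; rewrite ?leq_exp2l.
pose j := m./2.+1; have -> : m.+2 = j.*2 by rewrite /j; lia.
rewrite (@big_cat_nat _ _ _ j.+2) //=; last by lia.
rewrite -addnn expnD leq_mul //; first by apply: IH; rewrite /j; lia.
apply: leq_trans (bin_central_le j); apply: dvdn_leq.
  by rewrite bin_gt0; lia.
rewrite -big_filter; apply: prod_primes_dvdn.
- by rewrite filter_uniq // iota_uniq.
- by apply/allP => p; rewrite mem_filter => /andP[].
- apply/allP => p; rewrite mem_filter mem_index_iota => /andP[pp /andP[h1 h2]].
  by apply: prime_dvd_bin_central => //; lia.
Qed.

(** * Prime factorization of [G n] *)

Lemma prod_prime_factors (m N : nat) : 0 < m ->
  (forall p, prime p -> p %| m -> p < N) ->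
  m = \prod_(0 <= p < N | prime p) p ^ logn p m.
Proof.
move=> m0 h.
have -> : \prod_(0 <= p < N | prime p) p ^ logn p m
        = \prod_(0 <= p < m.+1 | p \in \pi(m)) p ^ logn p m.
  rewrite [LHS](big_nat_widen 0 _ (N + m.+1)) ?leq_addr //.
  rewrite [RHS](big_nat_widen 0 _ (N + m.+1)) ?leq_addl //.
  rewrite [LHS]big_mkcond [RHS]big_mkcond; apply: eq_bigr => p _.
  rewrite mem_primes m0 /=.
  case: (boolP (prime p)) => //= pp.
  have [d|nd] := boolP (p %| m).
    by rewrite h // ltnS dvdn_leq.
  by rewrite lognE pp m0 (negbTE nd) expn0 if_same.
by rewrite -[LHS]partn_pi // /partn.
Qed.

(** The quantity [D_q] of the overview. For [q > 1] the natural subtraction never truncates, by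
    [floor_gap_term_ge], and the terms from [j = n] on would be zero. *)
Definition floor_gap (n q : nat) : nat :=
  \sum_(0 <= j < n) (n %/ (q ^ j * q.-1) - n %/ q ^ j.+1).

Lemma floor_gap_term_ge n q j : 1 < q -> n %/ q ^ j.+1 <= n %/ (q ^ j * q.-1).
Proof.
move=> q1; rewrite leq_div2l ?expnSr ?leq_mul2l ?leq_pred ?orbT //.
by rewrite muln_gt0 expn_gt0; lia.
Qed.

Lemma logn_fact_gap n q : prime q ->
  \sum_(j < n) n %/ (q ^ j * q.-1) = logn q n`! + floor_gap n q.
Proof.
move=> pq; rewrite logn_fact // big_add1 /= -(big_mkord xpredT (fun j => n %/ (q ^ j * q.-1))).
rewrite /floor_gap -big_split /=; apply: eq_bigr => j _.
by rewrite subnKC // floor_gap_term_ge // prime_gt1.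
Qed.

(** For [q = 2] the factor [q - 1] is 1, so the two families of quotients are shifts of one another
    and the sum telescopes to [n - n %/ 2 ^ n]. *)
Lemma floor_gap2 n : floor_gap n 2 = n.
Proof.
rewrite /floor_gap.
under eq_bigr do rewrite muln1.
suff h k : \sum_(0 <= j < k) (n %/ 2 ^ j - n %/ 2 ^ j.+1) = n - n %/ 2 ^ k.
  by rewrite h [n %/ _]divn_small ?subn0 // ltn_expl.
elim: k => [|k IH]; first by rewrite big_geq // expn0 divn1 subnn.
rewrite big_nat_recr //= IH.
have := floor_gap_term_ge n k (isT : 1 < 2).
rewrite muln1; have := leq_div n (2 ^ k); lia.
Qed.

Lemma r_odd n q : odd_prime q -> r n q = logn q n`! + floor_gap n q.
Proof.
move=> /andP[pq q2]; rewrite /r ifF; last lia.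
by rewrite floor_sumE ?prime_gt1 // logn_fact_gap.
Qed.

Lemma r_two n : r n 2 = n %/ 2 + logn 2 n`! + n.
Proof. by rewrite /r eqxx floor_sumE // logn_fact_gap // floor_gap2 addnA. Qed.

(** From [j = 1] on both divisors exceed [n]. *)
Lemma floor_gap_large n q : 1 < q -> n < q * q.-1 ->
  floor_gap n q = n %/ q.-1 - n %/ q.
Proof.
move=> q1 h; rewrite /floor_gap; case: n h => [|n] h.
  by rewrite big_geq // !div0n.
rewrite big_nat_recl // big1_seq ?addn0 ?expn0 ?mul1n ?expn1 //.
move=> j _; rewrite [X in X - _]divn_small // expnS -mulnA mulnCA.
by apply: leq_trans h _; rewrite leq_pmull // expn_gt0; lia.
Qed.

(** The gap is at most 1. If it is 1, then [m = n %/ q.-1] satisfies [n %/ m = q.-1] and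
    [m <= q.-1], hence [m ^ 2 <= n]. Stating this as a count over [m] allows the sums over [q] and
    [m] to be interchanged later. *)
Lemma floor_gap_large_le n q M : 1 < q -> n < q * q.-1 -> n < M.+1 ^ 2 ->
  floor_gap n q <= \sum_(1 <= m < M.+1) (n %/ m == q.-1).
Proof.
move=> q1 h hM; rewrite floor_gap_large //.
have [e|ne] := eqVneq (n %/ q.-1) (n %/ q); first by rewrite e subnn.
set m := n %/ q.-1.
have lm : m <= (n %/ q).+1.
  rewrite /m -ltnS ltn_divLR; last lia.
  have := ltn_ceil n (_ : 0 < q); rewrite -/(n %/ q) => /(_ ltac:(lia)).
  have := leq_divM n q; nia.
have m1 : n %/ q < m.
  have := leq_div2l n (_ : 0 < q.-1) (leq_pred q); rewrite -/m; lia.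
have hm1 : m * q.-1 <= n by rewrite /m leq_divM.
have hm2 : n < m * q by rewrite -ltn_divLR; lia.
have mq : n %/ m = q.-1.
  apply/eqP; rewrite eqn_leq leq_divRL ?hm1 ?andbT; last lia.
  rewrite -ltnS ltn_divLR ?prednK //; nia.
have mle : m <= q.-1 by rewrite /m -ltnS prednK ?ltn_divLR; lia.
have mm : m * m <= n by apply: leq_trans hm1; rewrite leq_mul2l mle orbT.
have mM : m <= M by rewrite -ltnS -(ltn_exp2r _ _ (isT : 0 < 2)) expnS expn1; lia.
rewrite (bigD1_seq m) /= ?iota_uniq //; first by rewrite mq eqxx; lia.
by rewrite mem_index_iota ltnS mM andbT; lia.
Qed.

Local Open Scope R_scope.
Local Arguments INR : simpl never.
Local Arguments Z.of_nat : simpl never.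
Local Arguments Z.mul : simpl never.
Local Arguments Z.sub : simpl never.

(** * Finite real sums *)

HB.instance Definition _ := Monoid.isComLaw.Build R 0 Rplus
  (fun x y z => esym (Rplus_assoc x y z)) Rplus_comm Rplus_0_l.

Reserved Notation "\rsum_ ( m <= i < n | P ) F"
  (at level 41, F at level 41, i, m, n at level 50).
Reserved Notation "\rsum_ ( m <= i < n ) F"
  (at level 41, F at level 41, i, m, n at level 50).
Notation "\rsum_ ( m <= i < n | P ) F" :=
  (\big[Rplus/0]_(m <= i < n | P%B) F) : R_scope.
Notation "\rsum_ ( m <= i < n ) F" :=
  (\big[Rplus/0]_(m <= i < n) F) : R_scope.

Section RealSumsMorph.
Variables (I : Type) (s : seq I) (P : pred I).

Lemma rsum_scal (c : R) (F : I -> R) :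
  \big[Rplus/0]_(i <- s | P i) (c * F i) = c * \big[Rplus/0]_(i <- s | P i) F i.
Proof.
apply: (big_ind2 (fun x y => x = c * y)) => [|x1 x2 y1 y2 -> ->|//]; ring.
Qed.

Lemma rsum_opp (F : I -> R) :
  \big[Rplus/0]_(i <- s | P i) (- F i) = - \big[Rplus/0]_(i <- s | P i) F i.
Proof.
apply: (big_ind2 (fun x y => x = - y)) => [|x1 x2 y1 y2 -> ->|//]; ring.
Qed.

Lemma INR_sum (F : I -> nat) :
  INR (\sum_(i <- s | P i) F i) = \big[Rplus/0]_(i <- s | P i) INR (F i).
Proof. by apply: (big_morph INR) => // x y; rewrite plus_INR. Qed.

End RealSumsMorph.

Section RealSums.
Variables (I : eqType) (s : seq I) (P : pred I).

Lemma rsum_le (F1 F2 : I -> R) :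
  (forall i, i \in s -> P i -> F1 i <= F2 i) ->
  \big[Rplus/0]_(i <- s | P i) F1 i <= \big[Rplus/0]_(i <- s | P i) F2 i.
Proof.
move=> h; rewrite big_seq_cond [X in _ <= X]big_seq_cond.
apply: (big_ind2 (fun x y => x <= y)) => [|x1 x2 y1 y2|i /andP[]]; try lra.
exact: h.
Qed.

Lemma rsum_ge0 (F : I -> R) : (forall i, i \in s -> P i -> 0 <= F i) ->
  0 <= \big[Rplus/0]_(i <- s | P i) F i.
Proof.
move=> h; rewrite big_seq_cond; apply: (big_ind (fun x => 0 <= x)).
- lra.
- by move=> x y; lra.
- by move=> i /andP[]; exact: h.
Qed.

Lemma rsum_le_sub (Q : pred I) (F : I -> R) : (forall i, P i -> Q i) ->
  (forall i, i \in s -> Q i -> 0 <= F i) ->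
  \big[Rplus/0]_(i <- s | P i) F i <= \big[Rplus/0]_(i <- s | Q i) F i.
Proof.
move=> PQ F0; rewrite big_mkcond [X in _ <= X]big_mkcond big_seq [X in _ <= X]big_seq.
apply: (big_ind2 (fun x y => x <= y)) => [|x1 x2 y1 y2 /=|i si]; try lra.
have [Pi|_] := boolP (P i); first by rewrite (PQ _ Pi); lra.
have [Qi|_] := boolP (Q i); last lra.
exact: F0.
Qed.

End RealSums.

Lemma rsum_const (c : R) (n : nat) : \rsum_(0 <= i < n) c = INR n * c.
Proof.
elim: n => [|n IH]; first by rewrite big_geq // [INR _]/INR; ring.
by rewrite S_INR big_nat_recr //= IH; ring.
Qed.

Lemma INR_leq (m n : nat) : (m <= n)%N -> INR m <= INR n.
Proof. by move/leP; exact: le_INR. Qed.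

Lemma INR_ltn (m n : nat) : (m < n)%N -> INR m < INR n.
Proof. by move/ltP; exact: lt_INR. Qed.

Lemma INR_mul (m n : nat) : INR (m * n)%N = INR m * INR n.
Proof. exact: mult_INR. Qed.

Lemma INR_expn (m n : nat) : INR (m ^ n)%N = INR m ^ n.
Proof. by elim: n => [|n IH] //=; rewrite expnS INR_mul IH. Qed.

Lemma INR_pred (q : nat) : (0 < q)%N -> INR q.-1 = INR q - 1.
Proof. by case: q => // q _; rewrite S_INR /=; ring. Qed.

Lemma INR_ge1 (n : nat) : (0 < n)%N -> 1 <= INR n.
Proof. exact: INR_leq. Qed.

Lemma INR_gt0 (n : nat) : (0 < n)%N -> 0 < INR n.
Proof. by move/ltP; exact: lt_0_INR. Qed.

Lemma INR_div_bounds (n d : nat) : (0 < d)%N ->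
  INR (n %/ d) <= INR n / INR d < INR (n %/ d) + 1.
Proof.
move=> d0; have dR := INR_ge1 d0; split.
  apply/Rle_div_r; first lra.
  by rewrite -INR_mul; apply: INR_leq; rewrite leq_divM.
apply/Rlt_div_l; first lra.
by rewrite -S_INR -INR_mul; apply: INR_ltn; rewrite ltn_ceil.
Qed.

Lemma ln_ge0 (x : R) : 1 <= x -> 0 <= ln x.
Proof. by move=> h; rewrite -ln_1; apply: ln_le; lra. Qed.

Lemma ln_le_sub1 (x : R) : 0 < x -> ln x <= x - 1.
Proof.
move=> x0; have := exp_ineq1_le (ln x); rewrite exp_ln //; lra.
Qed.

Lemma ln_pow_INR (q j : nat) : (0 < q)%N -> ln (INR (q ^ j)) = INR j * ln (INR q).
Proof.
move=> q0; have := INR_ge1 q0 => h.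
elim: j => [|j IH]; first by rewrite expn0 ln_1 [INR 0]/INR; ring.
rewrite expnS INR_mul ln_mult ?IH ?S_INR; [ring|lra|].
by apply: INR_gt0; rewrite expn_gt0 q0.
Qed.

(** * Logarithms of prime factorizations *)

Lemma ln_prod (s : seq nat) (P : pred nat) (F : nat -> nat) :
  (forall i, P i -> (0 < F i)%N) ->
  ln (INR (\prod_(i <- s | P i) F i)) = \big[Rplus/0]_(i <- s | P i) ln (INR (F i)).
Proof.
move=> h.
suff [] : (0 < \prod_(i <- s | P i) F i)%N /\
  ln (INR (\prod_(i <- s | P i) F i)) = \big[Rplus/0]_(i <- s | P i) ln (INR (F i)) by [].
apply: (big_ind2 (fun x y => (0 < x)%N /\ ln (INR x) = y)).
- by rewrite [INR 1]/INR ln_1.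
- move=> x1 x2 y1 y2 [h1 <-] [h2 <-]; rewrite muln_gt0 h1 h2; split=> //.
  by rewrite INR_mul ln_mult //; apply: INR_gt0.
- by move=> i Pi; rewrite h.
Qed.

Lemma ln_prime_sum (m N : nat) : (0 < m)%N ->
  (forall p, prime p -> p %| m -> (p < N)%N) ->
  ln (INR m) = \rsum_(0 <= p < N | prime p) (INR (logn p m) * ln (INR p)).
Proof.
move=> m0 h; rewrite {1}(prod_prime_factors m0 h) ln_prod; last first.
  by move=> p pp; rewrite expn_gt0 prime_gt0.
by apply: eq_bigr => p pp; rewrite ln_pow_INR ?prime_gt0.
Qed.

Lemma big_prime_odd (N : nat) (F : nat -> R) :
  \rsum_(0 <= p < N.+3 | prime p) F p
    = F 2%N + \rsum_(0 <= p < N.+3 | odd_prime p) F p.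
Proof.
elim: N => [|N IH]; first by rewrite !unlock /=; ring.
rewrite big_mkcond big_nat_recr //= -big_mkcond IH.
rewrite [in RHS]big_mkcond [in RHS]big_nat_recr //= -big_mkcond Rplus_assoc.
by rewrite /odd_prime ltnS andbT.
Qed.

(** Every prime factor of [n!] lies below [n + 2], so one range of primes serves both [G n] and
    [n!]. The prime 2 contributes [n %/ 2] from the definition of [r] and [n] from [floor_gap2]. *)
Lemma ln_G (n : nat) : (0 < n)%N ->
  ln (INR (G n)) = ln (INR n`!) + (INR (n %/ 2) + INR n) * ln 2
    + \rsum_(0 <= q < n.+2 | odd_prime q) (INR (floor_gap n q) * ln (INR q)).
Proof.
case: n => // n _.
rewrite /G -(big_mkord prime (fun q => q ^ r n.+1 q)%N) ln_prod; last first.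
  by move=> q pq; rewrite expn_gt0 prime_gt0.
rewrite (@ln_prime_sum (n.+1)`! n.+3) ?fact_gt0 //; last first.
  by move=> p pp /(prime_dvd_fact pp) h; rewrite !ltnS; apply: leq_trans h _.
rewrite !big_prime_odd ln_pow_INR // r_two !plus_INR (_ : INR 2 = 2) //.
rewrite (eq_bigr (fun q => INR (logn q (n.+1)`!) * ln (INR q) + INR (floor_gap n.+1 q) * ln (INR q))).
  by rewrite big_split /=; ring.
move=> q oq; rewrite r_odd // ln_pow_INR; first by rewrite plus_INR; ring.
by case/andP: oq => /prime_gt0.
Qed.

(** * Floors against their real values at small primes *)

Definition nb_powers (n q : nat) : nat := (trunc_log q (n %/ q.-1)).+1.

Lemma nb_powersP (n q j : nat) : (1 < q)%N -> (q.-1 <= n)%N ->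
  (j < nb_powers n q)%N = (q ^ j * q.-1 <= n)%N.
Proof.
move=> q1 qn; have q0 : (0 < q.-1)%N by lia.
rewrite -leq_divRL // ltnS; apply/idP/idP => h; last exact: trunc_log_max.
apply: leq_trans (trunc_logP q1 _); last by rewrite divn_gt0.
by rewrite leq_exp2l.
Qed.

(** The summand equals [/ (q ^ j (q - 1)) - / q ^ j.+1], which is the summand of [floor_gap] with
    the floors and the factor [n] removed. *)
Lemma geom_gap_sum (q : R) (L : nat) : 1 < q ->
  \rsum_(0 <= j < L) (/ (q ^ j.+1 * (q - 1))) = (1 - / q ^ L) / (q - 1) ^ 2.
Proof.
move=> q1; elim: L => [|L IH].
  by rewrite big_geq //= Rinv_1; field; lra.
have qL : q ^ L <> 0 by apply: pow_nonzero; lra.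
rewrite big_nat_recr //= IH /=; field; lra.
Qed.

Lemma floor_gapE (n q : nat) : (1 < q)%N -> (q.-1 <= n)%N ->
  floor_gap n q =
    (\sum_(0 <= j < nb_powers n q) (n %/ (q ^ j * q.-1) - n %/ q ^ j.+1))%N.
Proof.
move=> q1 qn.
have Ln : (nb_powers n q <= n)%N.
  have := nb_powersP (trunc_log q (n %/ q.-1)) q1 qn; rewrite ltnSn => /esym h.
  apply: leq_trans h; apply: (leq_trans (ltn_expl _ q1)).
  by rewrite leq_pmulr //; lia.
rewrite /floor_gap (big_cat_nat (leq0n _) Ln) /= [X in (_ + X)%N]big1_seq ?addn0 //.
move=> j /andP[_]; rewrite mem_index_iota => /andP[hj _].
rewrite [X in (X - _)%N]divn_small // ltnNge -nb_powersP //; lia.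
Qed.

(** Each of the [nb_powers n q] surviving terms is within 1 of its value without floors. Truncating
    the geometric series costs at most [/ (q - 1)], and only in the lower bound. *)
Lemma floor_gap_bounds (n q : nat) : (1 < q)%N -> (q.-1 <= n)%N ->
  INR n / (INR q - 1) ^ 2 - INR (nb_powers n q) - / (INR q - 1)
   <= INR (floor_gap n q)
   <= INR n / (INR q - 1) ^ 2 + INR (nb_powers n q).
Proof.
move=> q1 qn; set L := nb_powers n q.
have qR : 2 <= INR q by apply: (@INR_leq 2).
have nR : 0 <= INR n by apply: pos_INR.
have hj j : INR n * / (INR q ^ j.+1 * (INR q - 1)) - 1
    <= INR (n %/ (q ^ j * q.-1) - n %/ q ^ j.+1)%N
    <= INR n * / (INR q ^ j.+1 * (INR q - 1)) + 1.
  rewrite minus_INR; last by apply/leP/floor_gap_term_ge.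
  have [] := @INR_div_bounds n (q ^ j * q.-1)%N; first by rewrite muln_gt0 expn_gt0; lia.
  have [] := @INR_div_bounds n (q ^ j.+1)%N; first by rewrite expn_gt0; lia.
  rewrite INR_mul !INR_expn INR_pred; last lia.
  have -> : INR n * / (INR q ^ j.+1 * (INR q - 1)) =
    INR n / (INR q ^ j * (INR q - 1)) - INR n / INR q ^ j.+1.
    have qj : INR q ^ j <> 0 by apply: pow_nonzero; lra.
    by rewrite /=; field; lra.
  lra.
have qL0 : 0 < INR q ^ L by apply: pow_lt; lra.
have gs : \rsum_(0 <= j < L) (INR n * / (INR q ^ j.+1 * (INR q - 1)))
   = INR n / (INR q - 1) ^ 2 - INR n / (INR q ^ L * (INR q - 1)) / (INR q - 1).
  by rewrite rsum_scal geom_gap_sum; [field; lra|lra].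
(* [L] is the first index with [n < q ^ L (q - 1)]; the omitted geometric tail is this ratio divided
   by [q - 1]. *)
have tail : 0 <= INR n / (INR q ^ L * (INR q - 1)) <= 1.
  have h : (n < q ^ L * q.-1)%N by rewrite ltnNge -nb_powersP // ltnn.
  have := INR_ltn h; rewrite INR_mul INR_expn INR_pred; last lia.
  move=> h'; split; first by apply: Rdiv_le_0_compat; nra.
  by apply/Rle_div_l; nra.
have i0 : 0 < / (INR q - 1) by apply: Rinv_0_lt_compat; lra.
rewrite floor_gapE // -/L INR_sum; move: gs; set X := INR n / (INR q - 1) ^ 2.
set Y := INR n / (INR q ^ L * (INR q - 1)) / (INR q - 1) => gs.
have Y01 : 0 <= Y <= / (INR q - 1).
  move: tail; rewrite /Y; set Z := INR n / (INR q ^ L * (INR q - 1)).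
  by rewrite /(Rdiv Z); nra.
split.
  apply: Rle_trans (_ : \rsum_(0 <= j < L) (INR n * / (INR q ^ j.+1 * (INR q - 1)) + -1) <= _).
    rewrite big_split /= gs rsum_const.
    lra.
  by apply: rsum_le => j _ _; have := hj j; lra.
apply: Rle_trans (_ : \rsum_(0 <= j < L) (INR n * / (INR q ^ j.+1 * (INR q - 1)) + 1) <= _).
  by apply: rsum_le => j _ _; have := hj j; lra.
by rewrite big_split /= gs rsum_const; lra.
Qed.

(** With [j] the last exponent such that [q ^ j (q - 1) <= n], the inequality [q <= 3/2 (q - 1)]
    yields [q ^ j.+1 <= 3/2 n]. *)
Lemma nb_powers_ln_le (n q : nat) : (2 < q)%N -> (q.-1 <= n)%N ->
  INR (nb_powers n q) * ln (INR q) <= ln (INR n) + ln (3 / 2).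
Proof.
move=> q1 qn; have q3 : 3 <= INR q by have := INR_leq q1; rewrite [INR 3]/INR; lra.
have := nb_powersP (trunc_log q (n %/ q.-1)) (ltnW q1) qn; rewrite ltnSn => /esym h.
have h' := INR_leq h; rewrite /nb_powers S_INR.
rewrite INR_mul INR_pred in h'; last lia.
set j := trunc_log _ _ in h' *.
have p0 : 0 < INR (q ^ j)%N by apply: INR_gt0; rewrite expn_gt0; lia.
have : ln (INR (q ^ j)%N * INR q) <= ln (INR n * (3 / 2)) by apply: ln_le; nra.
have n0 : 0 < INR n by nra.
rewrite !ln_mult; try lra.
rewrite ln_pow_INR; [lra|lia].
Qed.

Lemma nb_powers_le2 (n q : nat) : (1 < q)%N -> (q.-1 <= n)%N ->
  (n < q ^ 2 * q.-1)%N -> (nb_powers n q <= 2)%N.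
Proof. by move=> q1 qn h; rewrite leqNgt nb_powersP // -ltnNge. Qed.

(** * Fixed-point enclosures of logarithms *)

Lemma le_of_derive_ge0 (f f' : R -> R) (a b : R) : a <= b ->
  (forall x, a <= x <= b -> is_derive f x (f' x)) ->
  (forall x, a <= x <= b -> 0 <= f' x) -> f a <= f b.
Proof.
move=> ab df pf.
have [c [cab e]] : exists c, Rmin a b <= c <= Rmax a b /\ f b - f a = f' c * (b - a).
  apply: MVT_gen => x; rewrite Rmin_left // Rmax_right // => hx.
    by apply: df; lra.
  apply/continuity_pt_filterlim/ex_derive_continuous; exists (f' x); apply: df; lra.
rewrite Rmin_left // Rmax_right // in cab.
have := pf c cab; nra.
Qed.

(** The series of [2 artanh y = ln ((1 + y) / (1 - y))] up to degree 15. *)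
Definition atanh_poly (y : R) : R :=
  2 * (y + y ^ 3 / 3 + y ^ 5 / 5 + y ^ 7 / 7 + y ^ 9 / 9 + y ^ 11 / 11
       + y ^ 13 / 13 + y ^ 15 / 15).

(** Both bounds follow by differentiating in [y]: the truncation error has derivative
    [2 y^16 / (1 - y^2)], and its majorant is the geometric series obtained by lowering all omitted
    denominators to 17. *)
Lemma ln_atanh_bounds (y : R) : 0 <= y < 1 ->
  atanh_poly y <= ln ((1 + y) / (1 - y))
    <= atanh_poly y + 2 * y ^ 17 / (17 * (1 - y ^ 2)).
Proof.
move=> [y0 y1]; split.
  have h : ln ((1 + 0) / (1 - 0)) - atanh_poly 0 <= ln ((1 + y) / (1 - y)) - atanh_poly y.
    apply: (@le_of_derive_ge0 (fun y => ln ((1 + y) / (1 - y)) - atanh_poly y)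
              (fun y => 2 * y ^ 16 / (1 - y ^ 2))) => // x hx.
      rewrite /atanh_poly; auto_derive; last by rewrite /INR; field; nra.
      split; [lra | split => //]; apply: Rdiv_lt_0_compat; lra.
    apply: Rdiv_le_0_compat; last by nra.
    by have := pow_le x 16; lra.
  move: h; rewrite {1}/atanh_poly (_ : (1 + 0) / (1 - 0) = 1); last by field.
  rewrite ln_1; lra.
pose g y := atanh_poly y + 2 * y ^ 17 / (17 * (1 - y ^ 2)) - ln ((1 + y) / (1 - y)).
have h : g 0 <= g y.
  apply: (@le_of_derive_ge0 g (fun y => 4 * y ^ 18 / (17 * (1 - y ^ 2) ^ 2))) => // x hx.
    rewrite /g /atanh_poly; auto_derive; last by rewrite /INR; field; nra.
    split; first by nra.
    by split; [lra | split => //]; apply: Rdiv_lt_0_compat; lra.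
  apply: Rdiv_le_0_compat; last by apply: Rmult_lt_0_compat; [lra | apply: pow_lt; nra].
  by have := pow_le x 18; lra.
move: h; rewrite /g {1}/atanh_poly (_ : (1 + 0) / (1 - 0) = 1); last by field.
rewrite ln_1; lra.
Qed.

(** The fixed-point integers below count units of [10 ^ -13]. *)
Definition fx_scale : Z := (10 ^ 13)%Z.

(** Division rounded up, the counterpart of [Z.div] for upper bounds. *)
Definition cdiv (a b : Z) : Z := (- (- a / b))%Z.

Lemma IZR_div_le (a b : Z) : (0 < b)%Z -> IZR (a / b) <= IZR a / IZR b.
Proof.
move=> b0; have bR : 0 < IZR b by apply: IZR_lt.
apply/Rle_div_r => //; rewrite -mult_IZR; apply: IZR_le.
by rewrite Z.mul_comm; apply: Z.mul_div_le.
Qed.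

Lemma IZR_cdiv_ge (a b : Z) : (0 < b)%Z -> IZR a / IZR b <= IZR (cdiv a b).
Proof.
move=> b0; rewrite /cdiv opp_IZR.
by have := IZR_div_le (- a) b0; rewrite opp_IZR /Rdiv; lra.
Qed.

(* [d = 2 m - 1], so that [(1 + 1/d) / (1 - 1/d) = m / (m - 1)]. *)
Definition ln_step_num (d : Z) : Z :=
  (2 * (45045 * d ^ 14 + 15015 * d ^ 12 + 9009 * d ^ 10 + 6435 * d ^ 8
        + 5005 * d ^ 6 + 4095 * d ^ 4 + 3465 * d ^ 2 + 3003))%Z.

(** 45045 is the least common multiple of 3, 5, ..., 15, the denominators in [atanh_poly]. *)
Definition ln_step_lo (d : Z) : Z :=
  (fx_scale * ln_step_num d / (45045 * d ^ 15))%Z.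

(** The second summand is the remainder in [ln_atanh_bounds] at [y = 1/d], with the powers of [d]
    cleared. *)
Definition ln_step_hi (d : Z) : Z :=
  (cdiv (fx_scale * ln_step_num d) (45045 * d ^ 15)
   + cdiv (fx_scale * 2) (17 * d ^ 15 * (d ^ 2 - 1)))%Z.

Lemma fx_scale_gt0 : 0 < IZR fx_scale.
Proof. exact: IZR_lt. Qed.

Lemma ln_step_bounds (m : Z) : (2 <= m)%Z ->
  IZR (ln_step_lo (2 * m - 1)) <= IZR fx_scale * (ln (IZR m) - ln (IZR m - 1))
    <= IZR (ln_step_hi (2 * m - 1)).
Proof.
move=> m2; move ed: (2 * m - 1)%Z => d.
have d3 : (3 <= d)%Z by lia.
have mR : 2 <= IZR m by apply: IZR_le.
have dR : IZR d = 2 * IZR m - 1 by rewrite -ed minus_IZR mult_IZR.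
have S0 := fx_scale_gt0.
have y01 : 0 <= / IZR d < 1.
  split; first by apply/Rlt_le/Rinv_0_lt_compat; lra.
  by rewrite -Rinv_1; apply: Rinv_lt_contravar; lra.
have e : ln ((1 + / IZR d) / (1 - / IZR d)) = ln (IZR m) - ln (IZR m - 1).
  rewrite -ln_div; [|lra|lra]; congr ln; rewrite dR; field; lra.
have := ln_atanh_bounds y01; rewrite e => -[hl hu].
have h2 : IZR (d ^ 2) = IZR d ^ 2 := esym (pow_IZR d 2).
have h4 : IZR (d ^ 4) = IZR d ^ 4 := esym (pow_IZR d 4).
have h6 : IZR (d ^ 6) = IZR d ^ 6 := esym (pow_IZR d 6).
have h8 : IZR (d ^ 8) = IZR d ^ 8 := esym (pow_IZR d 8).
have h10 : IZR (d ^ 10) = IZR d ^ 10 := esym (pow_IZR d 10).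
have h12 : IZR (d ^ 12) = IZR d ^ 12 := esym (pow_IZR d 12).
have h14 : IZR (d ^ 14) = IZR d ^ 14 := esym (pow_IZR d 14).
have h15 : IZR (d ^ 15) = IZR d ^ 15 := esym (pow_IZR d 15).
have ep : IZR (fx_scale * ln_step_num d) / IZR (45045 * d ^ 15) = IZR fx_scale * atanh_poly (/ IZR d).
  (* The scale and the integer powers become variables, so that [field] does not expand them. *)
  rewrite /ln_step_num /atanh_poly; move: fx_scale h2 h4 h6 h8 h10 h12 h14 h15.
  move=> S; move: (d ^ 2)%Z (d ^ 4)%Z (d ^ 6)%Z (d ^ 8)%Z (d ^ 10)%Z (d ^ 12)%Z (d ^ 14)%Z (d ^ 15)%Z.
  move=> p2 p4 p6 p8 p10 p12 p14 p15 h2 h4 h6 h8 h10 h12 h14 h15.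
  rewrite !(mult_IZR, plus_IZR) h2 h4 h6 h8 h10 h12 h14 h15.
  by field; lra.
split.
  rewrite /ln_step_lo; apply: Rle_trans (IZR_div_le _ _) _; first by nia.
  by rewrite ep; apply: Rmult_le_compat_l; lra.
rewrite /ln_step_hi plus_IZR.
have c1 := IZR_cdiv_ge (fx_scale * ln_step_num d) (_ : 0 < 45045 * d ^ 15)%Z.
have c2 := IZR_cdiv_ge (fx_scale * 2) (_ : 0 < 17 * d ^ 15 * (d ^ 2 - 1))%Z.
apply: Rle_trans (Rplus_le_compat _ _ _ _ (c1 _) (c2 _)); try nia.
have -> : IZR (fx_scale * 2) / IZR (17 * d ^ 15 * (d ^ 2 - 1))
   = IZR fx_scale * (2 * (/ IZR d) ^ 17 / (17 * (1 - (/ IZR d) ^ 2))).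
  move: fx_scale h2 h15 => S; move: (d ^ 2)%Z (d ^ 15)%Z => p2 p15 h2 h15.
  rewrite !(mult_IZR, minus_IZR) h2 h15; field; nra.
by rewrite ep -Rmult_plus_distr_l; apply: Rmult_le_compat_l; lra.
Qed.

(* In units of [1 / fx_scale]: bounds for [ln (k + 1)] and for the sum of
   [num i / den i * ln i] over [1 <= i <= k + 1]. *)
Fixpoint ln_wsum (step : Z -> Z) (dv : Z -> Z -> Z) (num den : nat -> Z) (k : nat) : Z * Z :=
  if k is k'.+1 then
    let: (l, a) := ln_wsum step dv num den k' in
    let l' := (l + step (2 * Z.of_nat k.+1 - 1))%Z in
    (l', (a + dv (l' * num k.+1) (den k.+1))%Z)
  else (0%Z, 0%Z).

Lemma ln_S_sub (k : nat) :
  ln (IZR (Z.of_nat k.+2)) - ln (IZR (Z.of_nat k.+2) - 1) = ln (INR k.+2) - ln (INR k.+1).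
Proof. by rewrite -INR_IZR_INZ [INR k.+2]S_INR; congr (_ - ln _); ring. Qed.

Section WeightedSums.
Variables num den : nat -> Z.
Hypothesis num_ge0 : forall i, (0 < i)%N -> (0 <= num i)%Z.
(** Positivity starts at [i = 2]: the weight at [i = 1] meets [ln 1 = 0], and [rem_den] vanishes
    there. *)
Hypothesis den_gt0 : forall i, (1 < i)%N -> (0 < den i)%Z.

Let ln_term (i : nat) : R := IZR (num i) / IZR (den i) * ln (INR i).

Lemma ln_wsum_lo (k : nat) :
  IZR (ln_wsum ln_step_lo Z.div num den k).1 <= IZR fx_scale * ln (INR k.+1) /\
  IZR (ln_wsum ln_step_lo Z.div num den k).2
    <= IZR fx_scale * \rsum_(1 <= i < k.+2) ln_term i.
Proof.
elim: k => [|k /=].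
  by rewrite big_nat1 /ln_term [INR 1]/INR ln_1 /=; split; lra.
case: (ln_wsum _ _ _ _ _) => l a /= [hl ha].
have [hs _] := @ln_step_bounds (Z.of_nat k.+2) ltac:(lia).
rewrite ln_S_sub in hs.
set l' := (l + _)%Z.
have hl' : IZR l' <= IZR fx_scale * ln (INR k.+2) by rewrite /l' plus_IZR; lra.
split=> //; rewrite big_nat_recr //= Rmult_plus_distr_l plus_IZR.
apply: Rplus_le_compat => //.
have d0 : (0 < den k.+2)%Z by apply: den_gt0.
have n0 : 0 <= IZR (num k.+2) by apply/IZR_le/num_ge0.
apply: Rle_trans (IZR_div_le _ d0) _; rewrite mult_IZR /ln_term.
have -> : IZR fx_scale * (IZR (num k.+2) / IZR (den k.+2) * ln (INR k.+2))
  = (IZR fx_scale * ln (INR k.+2)) * IZR (num k.+2) / IZR (den k.+2) by rewrite /Rdiv; ring.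
apply: Rmult_le_compat_r; first by apply/Rlt_le/Rinv_0_lt_compat/IZR_lt.
exact: Rmult_le_compat_r.
Qed.

Lemma ln_wsum_hi (k : nat) :
  IZR fx_scale * ln (INR k.+1) <= IZR (ln_wsum ln_step_hi cdiv num den k).1 /\
  IZR fx_scale * (\rsum_(1 <= i < k.+2) ln_term i)
    <= IZR (ln_wsum ln_step_hi cdiv num den k).2.
Proof.
elim: k => [|k /=].
  by rewrite big_nat1 /ln_term [INR 1]/INR ln_1 /=; split; lra.
case: (ln_wsum _ _ _ _ _) => l a /= [hl ha].
have [_ hs] := @ln_step_bounds (Z.of_nat k.+2) ltac:(lia).
rewrite ln_S_sub in hs.
set l' := (l + _)%Z.
have hl' : IZR fx_scale * ln (INR k.+2) <= IZR l' by rewrite /l' plus_IZR; lra.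
split=> //; rewrite big_nat_recr //= Rmult_plus_distr_l plus_IZR.
apply: Rplus_le_compat => //.
have d0 : (0 < den k.+2)%Z by apply: den_gt0.
have n0 : 0 <= IZR (num k.+2) by apply/IZR_le/num_ge0.
apply: Rle_trans (IZR_cdiv_ge _ d0); rewrite mult_IZR /ln_term.
have -> : IZR fx_scale * (IZR (num k.+2) / IZR (den k.+2) * ln (INR k.+2))
  = (IZR fx_scale * ln (INR k.+2)) * IZR (num k.+2) / IZR (den k.+2) by rewrite /Rdiv; ring.
apply: Rmult_le_compat_r; first by apply/Rlt_le/Rinv_0_lt_compat/IZR_lt.
exact: Rmult_le_compat_r.
Qed.

End WeightedSums.

Lemma IZR_div_scale (z : Z) : IZR z / IZR fx_scale = IZR z / 10 ^ 13.
Proof. by rewrite pow_IZR. Qed.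

(** With weights 0 only the running logarithm matters. For numerals the premise is a closed boolean,
    settled by evaluation. *)
Lemma ln_fx_bounds (k : nat) (a b : Z) :
  ((a <=? (ln_wsum ln_step_lo Z.div (fun=> 0) (fun=> 1) k).1) &&
   ((ln_wsum ln_step_hi cdiv (fun=> 0) (fun=> 1) k).1 <=? b))%Z ->
  IZR a / 10 ^ 13 <= ln (INR k.+1) <= IZR b / 10 ^ 13.
Proof.
have S0 := fx_scale_gt0; rewrite -!IZR_div_scale.
move=> /andP[/Z.leb_le/IZR_le ha /Z.leb_le/IZR_le hb].
have [] := @ln_wsum_lo (fun=> 0%Z) (fun=> 1%Z) _ _ k => // h1 _.
have [] := @ln_wsum_hi (fun=> 0%Z) (fun=> 1%Z) _ _ k => // h2 _.
by split; [apply/Rle_div_l | apply/Rle_div_r]; lra.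
Qed.

Lemma ln2_bounds : 0.69314 <= ln 2 <= 0.693148.
Proof.
have := @ln_fx_bounds 1 6931400000000 6931480000000 erefl.
by rewrite (_ : INR 2 = 2) //; lra.
Qed.

Lemma INR_eq_IZR (n : nat) (z : Z) : Z.of_nat n = z -> INR n = IZR z.
Proof. by move=> <-; exact: INR_IZR_INZ. Qed.

Lemma INR_3 : INR 3 = 3.
Proof. exact: INR_eq_IZR. Qed.

Lemma ln3_bounds : 1.0986 <= ln 3 <= 1.09862.
Proof.
have := @ln_fx_bounds 2 10986000000000 10986200000000 erefl.
by rewrite INR_3; lra.
Qed.

(** * Elementary estimates *)

Local Arguments pow : simpl never.

Lemma sum_n_rsum (a : nat -> R) (N : nat) : sum_n a N = \rsum_(0 <= i < N.+1) a i.
Proof.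
elim: N => [|N IH]; first by rewrite sum_O big_nat1.
by rewrite sum_Sn IH [in RHS]big_nat_recr.
Qed.

(** * Series with nonnegative terms *)

Section NonnegSeries.
Variable a : nat -> R.
Hypothesis a_ge0 : forall i, 0 <= a i.

Lemma rsum_incr (N : nat) : \rsum_(0 <= i < N) a i <= \rsum_(0 <= i < N.+1) a i.
Proof. by rewrite [X in _ <= X]big_nat_recr //=; have := a_ge0 N; lra. Qed.

Lemma sum_n_incr (N : nat) : sum_n a N <= sum_n a N.+1.
Proof. by rewrite !sum_n_rsum; apply: rsum_incr. Qed.

Lemma ex_series_bounded (C : R) :
  (forall N, \rsum_(0 <= i < N) a i <= C) -> ex_series a.
Proof.
move=> h.
have [l hl] : ex_finite_lim_seq (sum_n a).
  apply: (@ex_finite_lim_seq_incr _ C) => N; first exact: sum_n_incr.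
  by rewrite sum_n_rsum.
by exists l.
Qed.

Lemma is_lim_sum_n : ex_series a -> is_lim_seq (sum_n a) (Series a).
Proof. by move/Series_correct. Qed.

Lemma rsum_le_Series (N : nat) : ex_series a -> \rsum_(0 <= i < N) a i <= Series a.
Proof.
move=> ea; apply: Rle_trans (rsum_incr N) _; rewrite -sum_n_rsum.
exact: (is_lim_seq_incr_compare _ _ (is_lim_sum_n ea) sum_n_incr).
Qed.

Lemma Series_le_bound (C : R) :
  (forall N, \rsum_(0 <= i < N) a i <= C) -> Series a <= C.
Proof.
move=> h; have ea := ex_series_bounded h.
have := @is_lim_seq_le (sum_n a) (fun=> C) (Series a) C _ (is_lim_sum_n ea) (is_lim_seq_const C).
by apply=> N; rewrite sum_n_rsum.
Qed.

End NonnegSeries.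

(** * Bounds for factorials and for the Chebyshev function *)

Lemma ln_S_le (n : nat) : (0 < n)%N -> ln (INR n.+1) - ln (INR n) <= / INR n.
Proof.
move=> n0; have nR := INR_gt0 n0.
rewrite -ln_div //; last exact: INR_gt0.
apply: Rle_trans (ln_le_sub1 _) _.
  by apply: Rdiv_lt_0_compat => //; apply: INR_gt0.
by rewrite S_INR; apply: Req_le; field; lra.
Qed.

(** Induction with [ln (1 + 1/n) <= 1/n]; the constant 1 makes it an equality at [n = 1]. *)
Lemma ln_fact_ge (n : nat) : (0 < n)%N ->
  INR n * ln (INR n) - INR n + 1 <= ln (INR n`!).
Proof.
elim: n => [//|[|n] IH] _; first by rewrite (_ : 1`! = 1%N) // [INR 1]/INR ln_1; lra.
rewrite factS INR_mul ln_mult; [|exact: INR_gt0|by apply: INR_gt0; rewrite fact_gt0].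
have h := @ln_S_le n.+1 isT; have nR : 0 < INR n.+1 by apply: INR_gt0.
have h2 : INR n.+1 * (ln (INR n.+2) - ln (INR n.+1)) <= 1.
  by rewrite -(Rinv_r (INR n.+1)); [apply: Rmult_le_compat_l; lra|lra].
by have := IH isT; rewrite [INR n.+2]S_INR in h2 *; lra.
Qed.

(** For [y = / (2n + 1)] the ratio [(1 + y) / (1 - y)] is [(n + 1) / n], and the first term [2 y] of
    the artanh series is already [/ (n + 1/2)]. *)
Lemma ln_S_ge (n : nat) : (0 < n)%N -> 1 <= (INR n + / 2) * (ln (INR n.+1) - ln (INR n)).
Proof.
move=> n0; have nR := INR_ge1 n0; set y := / (2 * INR n + 1).
have y01 : 0 < y < 1.
  split; first by apply: Rinv_0_lt_compat; lra.
  by rewrite -Rinv_1; apply: Rinv_lt_contravar; lra.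
have [h _] := @ln_atanh_bounds y ltac:(lra).
have e : (1 + y) / (1 - y) = INR n.+1 / INR n by rewrite /y S_INR; field; lra.
rewrite e ln_div in h; [|exact: INR_gt0|lra].
have h2 : 2 * y <= ln (INR n.+1) - ln (INR n).
  apply: Rle_trans h; rewrite /atanh_poly.
  have p k : 0 <= y ^ k by apply: pow_le; lra.
  by move: (p 3%N) (p 5%N) (p 7%N) (p 9%N) (p 11%N) (p 13%N) (p 15%N); lra.
have e2 : (INR n + / 2) * (2 * y) = 1 by rewrite /y; field; lra.
by rewrite -e2; apply: Rmult_le_compat_l; lra.
Qed.

(** A Stirling bound with constant 1 in place of [ln (sqrt (2 * PI))]; its induction step is exactly
    [ln_S_ge]. *)
Lemma ln_fact_le (n : nat) : (0 < n)%N ->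
  ln (INR n`!) <= (INR n + / 2) * ln (INR n) - INR n + 1.
Proof.
elim: n => [//|[|n] IH] _; first by rewrite (_ : 1`! = 1%N) // [INR 1]/INR ln_1; lra.
rewrite factS INR_mul ln_mult; [|exact: INR_gt0|by apply: INR_gt0; rewrite fact_gt0].
have h := @ln_S_ge n.+1 isT.
by have := IH isT; rewrite [INR n.+2]S_INR in h *; lra.
Qed.

Lemma theta_le (m : nat) :
  \rsum_(0 <= p < m.+2 | prime p) ln (INR p) <= INR m * (2 * ln 2).
Proof.
rewrite -ln_prod; last by move=> p /prime_gt0.
have -> : INR m * (2 * ln 2) = ln (INR (4 ^ m)).
  rewrite ln_pow_INR // (_ : INR 4 = 2 * 2); first by rewrite ln_mult; lra.
  by rewrite !S_INR [INR 0]/INR; lra.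
apply: ln_le; first by apply: INR_gt0; rewrite prodn_cond_gt0 // => p /prime_gt0.
exact/INR_leq/primorial_le.
Qed.

(** * Partial sums and tail of the series [K] *)

Lemma odd_prime_even (i : nat) : odd_prime i.*2 = false.
Proof. by apply/negbTE/negP => /andP[/even_prime]; lia. Qed.

(** Primality is relaxed to oddness, which still halves the number of terms. *)
Lemma rsum_odd_prime_le (f : nat -> R) (k N : nat) : (k <= N)%N ->
  (forall i, (k <= i)%N -> 0 <= f i.*2.+1) ->
  \rsum_(k.*2 <= q < N.*2 | odd_prime q) f q <= \rsum_(k <= i < N) f i.*2.+1.
Proof.
move=> kN f0; rewrite -(subnKC kN); elim: (N - k)%N => [|d IH].
  by rewrite addn0 !big_geq //; lra.
rewrite addnS doubleS big_mkcond big_nat_recr /=; last by lia.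
rewrite big_nat_recr /=; last by lia.
rewrite -big_mkcond odd_prime_even [X in _ <= X]big_nat_recr /=; last by lia.
have := f0 (k + d)%N (leq_addr _ _).
case: ifP => _; lra.
Qed.

(** With [u = q - 1] the left side is a term of [K]. The right side is a difference
    [F u - F (u + 2)], with [F] modelled on [(ln u + 1) / (2 u)], half the tail integral of
    [ln u / u^2]; the shift to [u - 1] and the constant 3/2 supply the slack. *)
Lemma ln_sq_telescope (u : R) : 2 <= u ->
  ln (u + 1) / u ^ 2 <=
   (ln u + 3 / 2) / (2 * (u - 1)) - (ln (u + 2) + 3 / 2) / (2 * (u + 1)).
Proof.
move=> u2; have lu : 0 <= ln u by apply: ln_ge0; lra.
have h1 : ln (u + 1) <= ln u + / u.
  have := @ln_le_sub1 ((u + 1) / u) ltac:(apply: Rdiv_lt_0_compat; lra).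
  rewrite ln_div; [|lra|lra].
  by rewrite (_ : (u + 1) / u - 1 = / u); [lra|field; lra].
have h2 : ln (u + 2) <= ln u + 2 / u.
  have := @ln_le_sub1 ((u + 2) / u) ltac:(apply: Rdiv_lt_0_compat; lra).
  rewrite ln_div; [|lra|lra].
  by rewrite (_ : (u + 2) / u - 1 = 2 / u); [lra|field; lra].
apply: Rle_trans (_ : (ln u + / u) / u ^ 2 <= _).
  by apply: Rmult_le_compat_r => //; apply/Rlt_le/Rinv_0_lt_compat; nra.
apply: Rle_trans (_ : (ln u + 3 / 2) / (2 * (u - 1)) - (ln u + 2 / u + 3 / 2) / (2 * (u + 1)) <= _); last first.
  suff : (ln (u + 2) + 3 / 2) / (2 * (u + 1)) <= (ln u + 2 / u + 3 / 2) / (2 * (u + 1)) by lra.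
  by apply: Rmult_le_compat_r; [apply/Rlt_le/Rinv_0_lt_compat|]; lra.
apply/Rminus_le_0; set l := ln u in lu *.
(* The numerator is affine in [l] with positive slope, and its constant part simplifies to
   [u^3 / 2 + 1]. *)
have -> : (l + 3 / 2) / (2 * (u - 1)) - (l + 2 / u + 3 / 2) / (2 * (u + 1)) - (l + / u) / u ^ 2
  = (l * u + (3 / 2 * u ^ 3 - u ^ 2 * (u - 1) - (u ^ 2 - 1))) / (u ^ 3 * (u - 1) * (u + 1)).
  by field; lra.
apply: Rdiv_le_0_compat; first by nra.
by apply: Rmult_lt_0_compat; [apply: Rmult_lt_0_compat; [apply: pow_lt|]|]; lra.
Qed.

Lemma INR_double (i : nat) : INR i.*2 = 2 * INR i.
Proof. by rewrite -addnn plus_INR; ring. Qed.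

(** A name for the summand of [K], so that [K] is convertible to [Series K_term]. *)
Definition K_term (q : nat) : R :=
  if odd_prime q then ln (INR q) / (INR q - 1) ^ 2 else 0.

Lemma K_term_ge0 (q : nat) : 0 <= K_term q.
Proof.
rewrite /K_term; case: ifP => [/andP[_ q2]|_]; last lra.
have := INR_leq q2; rewrite INR_3 => h.
by apply: Rdiv_le_0_compat; [apply: ln_ge0; lra | apply: pow_lt; lra].
Qed.

Lemma rsum_K_term (m N : nat) : \rsum_(m <= q < N) K_term q
  = \rsum_(m <= q < N | odd_prime q) (ln (INR q) / (INR q - 1) ^ 2).
Proof. by rewrite [in RHS]big_mkcond. Qed.

Lemma K_tail_le (k N : nat) : (0 < k)%N ->
  \rsum_(k.*2 <= q < N) K_term q
   <= (ln (2 * INR k) + 3 / 2) / (2 * (2 * INR k - 1)).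
Proof.
move=> k0; have kR := INR_ge1 k0.
pose F u := (ln u + 3 / 2) / (2 * (u - 1)).
have F0 u : 2 <= u -> 0 <= F u.
  move=> u2; apply: Rdiv_le_0_compat; last lra.
  by have := @ln_ge0 u ltac:(lra); lra.
have tele u : 2 <= u -> ln (u + 1) / u ^ 2 <= F u - F (u + 2).
  by move/ln_sq_telescope; rewrite /F (_ : u + 2 - 1 = u + 1); last by ring.
have main d : \rsum_(k <= i < k + d) (ln (INR i.*2.+1) / (INR i.*2.+1 - 1) ^ 2) <= F (2 * INR k) - F (2 * INR (k + d)).
  elim: d => [|d IH]; first by rewrite addn0 big_geq //; lra.
  rewrite addnS big_nat_recr /=; last by lia.
  have := INR_leq (leq_addr d k) => kd.
  have := @tele (2 * INR (k + d)) ltac:(lra).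
  rewrite [INR (k + d).*2.+1]S_INR INR_double [INR (k + d).+1]S_INR.
  rewrite (_ : 2 * INR (k + d) + 1 - 1 = 2 * INR (k + d)); last by ring.
  rewrite (_ : 2 * (INR (k + d) + 1) = 2 * INR (k + d) + 2); last by ring.
  by move: IH; lra.
have [Nk|kN] := leqP N k.*2.
  by rewrite big_geq //; apply: F0; lra.
(* An even endpoint is needed for [rsum_odd_prime_le]. *)
apply: Rle_trans (_ : \rsum_(k.*2 <= q < N.*2) K_term q <= _).
  rewrite [X in _ <= X](@big_cat_nat _ _ _ N) /=; [|lia|lia].
  have : 0 <= \rsum_(N <= q < N.*2) K_term q by apply: rsum_ge0 => *; exact: K_term_ge0.
  lra.
rewrite rsum_K_term; apply: Rle_trans (rsum_odd_prime_le (f := fun q => ln (INR q) / (INR q - 1) ^ 2) _ _) _; first by lia.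
  move=> i ki; rewrite S_INR INR_double.
  have := INR_leq ki => kiR; apply: Rdiv_le_0_compat; first by apply: ln_ge0; lra.
  by apply: pow_lt; lra.
rewrite -(_ : k + (N - k) = N)%N; last by lia.
apply: Rle_trans (main _) _.
by have := @F0 (2 * INR (k + (N - k))) ltac:(have := INR_leq (leq_addr (N - k) k); lra); rewrite -/(F _); lra.
Qed.

Lemma K_partial_le (k N : nat) : (0 < k)%N ->
  \rsum_(0 <= q < N) K_term q <= \rsum_(0 <= q < k.*2) K_term q
   + (ln (2 * INR k) + 3 / 2) / (2 * (2 * INR k - 1)).
Proof.
move=> k0; have tl := @K_tail_le k (k.*2 + N) k0.
have nn m p : 0 <= \rsum_(m <= q < p) K_term q by apply: rsum_ge0 => *; exact: K_term_ge0.
apply: Rle_trans (_ : \rsum_(0 <= q < k.*2 + N) K_term q <= _).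
  rewrite [X in _ <= X](@big_cat_nat _ _ _ N) //=; last by lia.
  by have := nn N (k.*2 + N)%N; lra.
by rewrite (@big_cat_nat _ _ _ k.*2) //=; [lra | lia].
Qed.

Lemma ex_series_K : ex_series K_term.
Proof. exact: (ex_series_bounded K_term_ge0 (fun N => @K_partial_le 1 N isT)). Qed.

Lemma K_ge (N : nat) : \rsum_(0 <= q < N) K_term q <= K.
Proof. exact: (rsum_le_Series K_term_ge0 _ ex_series_K). Qed.

Lemma K_le (k : nat) : (0 < k)%N ->
  K <= \rsum_(0 <= q < k.*2) K_term q
   + (ln (2 * INR k) + 3 / 2) / (2 * (2 * INR k - 1)).
Proof. by move=> k0; apply: (Series_le_bound K_term_ge0) => N; exact: K_partial_le. Qed.

(** * Large and small primes *)

Lemma rsum_single_le (s : seq nat) (P : pred nat) (c : nat) (x : R) :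
  uniq s -> 0 <= x ->
  \big[Rplus/0]_(q <- s | P q) (if q == c then x else 0) <= x.
Proof.
move=> us x0; apply: Rle_trans (_ : \big[Rplus/0]_(q <- s) (if q == c then x else 0) <= _).
  by apply: rsum_le_sub => // q _ _; case: ifP => _; lra.
have [cs|ncs] := boolP (c \in s).
  rewrite (bigD1_seq c) //= eqxx big1; first lra.
  by move=> q /negbTE ->.
rewrite big_seq big1 // => q qs; rewrite ifF //.
by apply/negbTE; apply: contraNN ncs => /eqP <-.
Qed.

(** After interchanging the sums, each [m <= sqrt n] contributes at most one prime, namely
    [n %/ m + 1]. The resulting sum of logarithms is about [M ln n - ln M!] with [M] the integer
    part of [sqrt n]. *)
Lemma rsum_large_gap_le (n k : nat) : (0 < n)%N -> (n < k.*2 * k.*2.+1)%N ->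
  \rsum_(k.*2 <= q < n.+2 | odd_prime q) (INR (floor_gap n q) * ln (INR q))
   <= / 2 * sqrt (INR n) * ln (INR n) + sqrt (INR n).
Proof.
move=> n0 hk; have nR := INR_ge1 n0.
have [M /andP[M1 M2]] : exists M, (M ^ 2 <= n < M.+1 ^ 2)%N.
  have ex : exists M, (M ^ 2 <= n)%N by exists 0%N.
  have bd M : (M ^ 2 <= n)%N -> (M <= n)%N.
    by case: M => // M; rewrite expnS expn1; nia.
  exists (ex_maxn ex bd); case: ex_maxnP => M hM maxM; rewrite hM /=.
  by rewrite ltnNge; apply/negP => /maxM; rewrite ltnn.
have M0 : (0 < M)%N by case: M M1 M2 => // _; rewrite exp1n; lia.
set s := sqrt (INR n).
have s2 : s * s = INR n by apply: sqrt_sqrt; lra.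
have s1 : 1 <= s by rewrite -sqrt_1; apply: sqrt_le_1_alt.
have Ms : INR M <= s.
  by have := INR_leq M1; rewrite INR_expn => h; rewrite /s -(sqrt_pow2 (INR M)) //; [apply: sqrt_le_1_alt | exact: pos_INR].
have MR := INR_ge1 M0.
have tln : ln (INR n) = 2 * ln s by rewrite -s2 ln_mult; lra.
apply: Rle_trans (_ : \rsum_(1 <= m < M.+1) ln (INR (n %/ m).+1) <= _).
  apply: Rle_trans (_ : \rsum_(k.*2 <= q < n.+2 | odd_prime q)
     \rsum_(1 <= m < M.+1) (if q == (n %/ m).+1 then ln (INR (n %/ m).+1) else 0) <= _).
    apply: rsum_le => q; rewrite mem_index_iota => /andP[hq1 _] oq.
    have /andP[pq q2] := oq.
    (* Strictness matters: [q >= 2k + 1] is what gives [n < q (q - 1)]. *)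
    have hq : (k.*2 < q)%N.
      by rewrite ltn_neqAle hq1 andbT; apply/eqP => e; rewrite -e odd_prime_even in oq.
    have nq : (n < q * q.-1)%N by nia.
    have := INR_leq (floor_gap_large_le (prime_gt1 pq) nq M2) => h.
    have lq : 0 <= ln (INR q) by apply/ln_ge0/INR_ge1/prime_gt0.
    apply: Rle_trans (Rmult_le_compat_r _ _ _ lq h) _.
    rewrite INR_sum [X in X <= _]Rmult_comm -rsum_scal; apply: rsum_le => m _ _.
    have [e|ne] := eqVneq (n %/ m) q.-1.
      by rewrite e prednK ?prime_gt0 // !eqxx (_ : INR true = 1) //; lra.
    rewrite ifF; last by lia.
    by rewrite (_ : INR false = 0) //; lra.
  rewrite exchange_big /=; apply: rsum_le => m _ _.
  by apply: rsum_single_le; [exact: iota_uniq | apply/ln_ge0/INR_ge1].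
have step j : (j <= M)%N ->
    \rsum_(1 <= m < j.+1) ln (INR (n %/ m).+1) <= INR j * (ln (INR n) + / s) - ln (INR j`!).
  elim: j => [|j IH] jM.
    by rewrite big_geq // fact0 [INR 1]/INR ln_1 [INR 0]/INR; lra.
  rewrite big_nat_recr //= factS INR_mul ln_mult; [|exact: INR_gt0|by apply: INR_gt0; rewrite fact_gt0].
  have jR : 1 <= INR j.+1 by apply: INR_ge1.
  have jM' := INR_leq jM.
  (* Since [j.+1 <= M <= s], the quotient [n / j.+1] is at least [s], so adding 1 costs at most a
     factor [1 + / s]. *)
  have h : ln (INR (n %/ j.+1).+1) <= ln (INR n) - ln (INR j.+1) + / s.
    have [d1 _] := @INR_div_bounds n j.+1 isT.
    apply: Rle_trans (_ : ln (INR n / INR j.+1 * (1 + / s)) <= _).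
      apply: ln_le; first exact: INR_gt0.
      rewrite S_INR.
      suff : 1 <= INR n / INR j.+1 * / s by lra.
      rewrite -s2 (_ : s * s / INR j.+1 * / s = s / INR j.+1); last by field; lra.
      by apply/Rle_div_r; lra.
    have is0 : 0 < / s by apply: Rinv_0_lt_compat; lra.
    rewrite ln_mult; [|by apply: Rdiv_lt_0_compat; lra|lra].
    rewrite ln_div; [|lra|lra].
    by have := @ln_le_sub1 (1 + / s) ltac:(lra); lra.
  by have := IH (ltnW jM); rewrite [in INR j.+1 * _]S_INR; lra.
apply: Rle_trans (step M (leqnn M)) _.
have hf := ln_fact_ge M0.
(* Replaces [ln M] by [ln s] although [M] may be smaller than [s]; the loss [s - M] cancels against
   the [M] from [ln_fact_ge]. *)
have hl : INR M * (ln s - ln (INR M)) <= s - INR M.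
  rewrite -ln_div; [|lra|lra].
  have := @ln_le_sub1 (s / INR M) ltac:(apply: Rdiv_lt_0_compat; lra).
  move/(Rmult_le_compat_l (INR M) _ _ ltac:(lra)).
  by rewrite (_ : INR M * (s / INR M - 1) = s - INR M); [|field; lra].
have hs : INR M * / s <= 1.
  by apply: (Rmult_le_reg_r s); [lra|]; rewrite Rmult_assoc Rinv_l; lra.
have ls : 0 <= ln s by apply: ln_ge0.
have hm : INR M * ln s <= s * ln s by apply: Rmult_le_compat_r.
rewrite tln Rmult_plus_distr_l; lra.
Qed.

Lemma rsum_if_le (B k : nat) (c : R) : 0 <= c ->
  \rsum_(1 <= i < k) (if (i <= B)%N then c else 0) <= INR B * c.
Proof.
move=> c0.
suff h d : \rsum_(1 <= i < d.+1) (if (i <= B)%N then c else 0) <= INR (minn d B) * c.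
  case: k => [|k]; first by rewrite big_geq //; apply: Rmult_le_pos => //; exact: pos_INR.
  apply: Rle_trans (h k) _; apply: Rmult_le_compat_r => //.
  by apply: INR_leq; rewrite geq_minr.
elim: d => [|d IH]; first by rewrite big_geq // min0n [INR 0]/INR; lra.
rewrite big_nat_recr //=; have [h|h] := boolP (d < B)%N.
  rewrite (_ : minn d.+1 B = (minn d B).+1); last by lia.
  by rewrite S_INR; lra.
by rewrite (_ : minn d.+1 B = minn d B); [lra | lia].
Qed.

Lemma ln6_ge : 1.791 <= ln 6.
Proof.
rewrite (_ : 6 = 2 * 3) ?ln_mult; try lra.
by have := ln2_bounds; have := ln3_bounds; lra.
Qed.

Lemma sqrt_exp_half (x : R) : 0 < x -> sqrt x = exp (ln x / 2).
Proof.
move=> x0; have : exp (ln x / 2) * exp (ln x / 2) = x.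
  by rewrite -exp_plus (_ : ln x / 2 + ln x / 2 = ln x); [rewrite exp_ln|field].
move=> e; rewrite -{1}e sqrt_square //; exact/Rlt_le/exp_pos.
Qed.

(** Each Taylor bound is integrated from the preceding one. *)
Lemma exp_ge_poly4 (x : R) : 0 <= x ->
  1 + x + x ^ 2 / 2 + x ^ 3 / 6 + x ^ 4 / 24 <= exp x.
Proof.
move=> x0.
have h1 y : 0 <= y -> 1 + y <= exp y by move=> _; exact: exp_ineq1_le.
have h2 y : 0 <= y -> 1 + y + y ^ 2 / 2 <= exp y.
  move=> y0; pose g y := exp y - (1 + y + y ^ 2 / 2).
  have : g 0 <= g y.
    apply: (@le_of_derive_ge0 g (fun y => exp y - (1 + y))) => // z hz.
      by rewrite /g; auto_derive => //; rewrite [INR 2]/INR /pow; field.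
    by have := h1 z; lra.
  by rewrite /g exp_0 /pow; lra.
have h3 y : 0 <= y -> 1 + y + y ^ 2 / 2 + y ^ 3 / 6 <= exp y.
  move=> y0; pose g y := exp y - (1 + y + y ^ 2 / 2 + y ^ 3 / 6).
  have : g 0 <= g y.
    apply: (@le_of_derive_ge0 g (fun y => exp y - (1 + y + y ^ 2 / 2))) => // z hz.
      by rewrite /g; auto_derive => //; rewrite /INR /pow; field.
    by have := h2 z; lra.
  by rewrite /g exp_0 /pow; lra.
pose g y := exp y - (1 + y + y ^ 2 / 2 + y ^ 3 / 6 + y ^ 4 / 24).
have : g 0 <= g x.
  apply: (@le_of_derive_ge0 g (fun y => exp y - (1 + y + y ^ 2 / 2 + y ^ 3 / 6))) => // z hz.
    by rewrite /g; auto_derive => //; rewrite /INR /pow; field.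
  by have := h3 z; lra.
by rewrite /g exp_0 /pow; lra.
Qed.

(* With [w = ln x / 6] and [2 b <= exp (2 w)] this becomes a polynomial inequality
   in [w] after [exp w] is replaced by its Taylor polynomial of degree 4. *)
Lemma cube_root_log_le (x b : R) : 2 <= x -> 0 <= b -> (2 * b) ^ 3 <= x ->
  b * (ln x - ln 6) <= 227 / 1000 * sqrt x + 7 * sqrt x / ln x.
Proof.
move=> x2 b0 hb.
have [l6|g6] := Rle_or_lt x 6.
  have h6 : ln x <= ln 6 by apply: ln_le; lra.
  have lx : 0 < ln x by rewrite -ln_1; apply: ln_increasing; lra.
  have s0 := sqrt_pos x.
  have : 0 <= 7 * sqrt x / ln x by apply: Rdiv_le_0_compat; lra.
  nra.
set w := ln x / 6; have l6 := ln6_ge.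
have lx : ln 6 < ln x by apply: ln_increasing; lra.
have w0 : 0 < w by rewrite /w; lra.
have es : sqrt x = exp w * exp w * exp w.
  by rewrite sqrt_exp_half; [rewrite -!exp_plus; congr exp; rewrite /w; field|lra].
have bb : 2 * b <= exp w * exp w.
  have [->|bn] := Req_dec b 0.
    by have := exp_pos w; nra.
  have bp : 0 < 2 * b by lra.
  have : ln ((2 * b) ^ 3) <= ln x by apply: ln_le => //; apply: pow_lt.
  rewrite ln_pow // [INR 3]INR_3 => h.
  rewrite -exp_plus -[2 * b]exp_ln //.
  have [e|] := Req_dec (ln (2 * b)) (w + w); first by rewrite e; lra.
  by move=> ne; apply/Rlt_le/exp_increasing; rewrite /w in ne *; lra.
have ex := exp_pos w.
(* The claim after multiplication by [ln x = 6 w] and division by [exp w * exp w]: [5373 = 3 * 1791]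
   comes from the lower bound on [ln 6], and [1362 = 6 * 227]. *)
have key : w * (18 * w - 5373 / 1000) <= (1362 / 1000 * w + 7) * exp w.
  have := @exp_ge_poly4 w ltac:(lra) => hp.
  apply: Rle_trans (_ : (1362 / 1000 * w + 7) * (1 + w + w ^ 2 / 2 + w ^ 3 / 6 + w ^ 4 / 24) <= _); last first.
    by apply: Rmult_le_compat_l; lra.
  (* Hints for [nra]: the squares vanish at [w = 2], near the smallest margin of the polynomial
     inequality. *)
  have : 0 <= (w - 2) ^ 2 * w by apply: Rmult_le_pos; [apply: pow2_ge_0|lra].
  have : 0 <= (w ^ 2 - 4) ^ 2 by apply: pow2_ge_0.
  have : 0 <= (w - 2) ^ 2 by apply: pow2_ge_0.
  have : 0 <= w ^ 5 by apply: pow_le; lra.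
  by nra.
apply: (Rmult_le_reg_r (6 * w)); first lra.
have -> : (227 / 1000 * sqrt x + 7 * sqrt x / ln x) * (6 * w) = (1362 / 1000 * w + 7) * sqrt x.
  by rewrite (_ : ln x = 6 * w); [field; lra|rewrite /w; field].
rewrite es.
apply: Rle_trans (_ : / 2 * (exp w * exp w) * (6 * w - 1791 / 1000) * (6 * w) <= _).
  have : b * (ln x - ln 6) <= / 2 * (exp w * exp w) * (6 * w - 1791 / 1000).
    have -> : ln x = 6 * w by rewrite /w; field.
    apply: Rmult_le_compat; [lra|rewrite /w; lra|lra|rewrite /w; lra].
  by move=> h; apply: Rmult_le_compat_r; lra.
have := Rmult_le_compat_r (exp w * exp w) _ _ ltac:(nra) key; lra.
Qed.

Lemma rsum_odd_prime_from2 (f : nat -> R) (N : nat) : (1 < N)%N ->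
  \rsum_(0 <= q < N | odd_prime q) f q = \rsum_(2 <= q < N | odd_prime q) f q.
Proof.
move=> hN; rewrite (@big_cat_nat _ _ _ 2) //=.
by rewrite [X in X + _](_ : _ = 0) ?Rplus_0_l // big_mkcond unlock /=; ring.
Qed.

(** Two powers per prime cost [2 theta (sqrt n)]. A further cost of at most [ln n - ln 6] arises
    only if [q^2 (q - 1) <= n], and the odd [q >= 3] with this property number at most
    [n^(1/3) / 2]. *)
Lemma rsum_nb_powers_le (n k : nat) : (1 < n)%N -> (k.*2 * k.*2.+1 <= n)%N ->
  \rsum_(0 <= q < k.+1.*2 | odd_prime q) (INR (nb_powers n q) * ln (INR q))
   <= 3 * sqrt (INR n) + 7 * sqrt (INR n) / ln (INR n) - 2 * ln 2.
Proof.
move=> n2 hk; have l2 := ln2_bounds.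
have nR : 2 <= INR n by apply: (INR_leq n2).
set s := sqrt (INR n); set t := ln (INR n).
have s1 : 1 <= s by rewrite -sqrt_1; apply: sqrt_le_1_alt; lra.
have t0 : 0 < t by rewrite /t -ln_1; apply: ln_increasing; lra.
have st0 : 0 <= 7 * s / t by apply: Rdiv_le_0_compat; lra.
case: k hk => [|k] hk.
  by rewrite big_mkcond unlock /=; lra.
have ks : 2 * INR k.+1 <= s.
  have h : (k.+1.*2 ^ 2 <= n)%N by rewrite expnS expn1; nia.
  have := INR_leq h; rewrite INR_expn INR_double => h'.
  rewrite /s -(sqrt_pow2 (2 * INR k.+1)); last by have := pos_INR k.+1; lra.
  exact: sqrt_le_1_alt.
(* [theta_le] is used at [m = 2k + 2 <= s]; removing the prime 2 gains [ln 2]. *)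
have th : \rsum_(0 <= q < k.+2.*2 | odd_prime q) ln (INR q) <= s * (2 * ln 2) - ln 2.
  have := theta_le k.+1.*2; rewrite -!doubleS INR_double.
  rewrite [(k.+2.*2)%N in X in X -> _](_ : _ = (k.*2.+1).+3)%N; last by lia.
  rewrite big_prime_odd (_ : INR 2 = 2) // -(_ : k.+2.*2 = (k.*2.+1).+3)%N; last by lia.
  have : 2 * INR k.+1 * (2 * ln 2) <= s * (2 * ln 2) by apply: Rmult_le_compat_r; lra.
  lra.
(* The excess over [2 ln q]: [nb_powers_ln_le] gives [ln n + ln (3/2)], and
   [ln 6 + ln (3/2) = 2 ln 3 <= 2 ln q]. The maximum keeps [f] nonnegative for small [n]. *)
pose c := Rmax 0 (t - ln 6); have c0 : 0 <= c by apply: Rmax_l.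
pose f q := if (q ^ 2 * q.-1 <= n)%N then c else 0.
have f0 q : 0 <= f q by rewrite /f; case: ifP => _; lra.
(* An odd [q = 2i + 1] with [q^2 (q - 1) <= n] satisfies [(2i)^3 <= n], hence [i <= B]. *)
have [B /andP[B1 B2]] : exists B, (B.*2 ^ 3 <= n < B.+1.*2 ^ 3)%N.
  have ex : exists B, (B.*2 ^ 3 <= n)%N by exists 0%N.
  have bd B : (B.*2 ^ 3 <= n)%N -> (B <= n)%N.
    by case: B => // B; rewrite !expnS expn0; nia.
  exists (ex_maxn ex bd); case: ex_maxnP => B hB maxB; rewrite hB /=.
  by rewrite ltnNge; apply/negP => /maxB; rewrite ltnn.
have hf : \rsum_(0 <= q < k.+2.*2 | odd_prime q) f q <= INR B * c.
  rewrite rsum_odd_prime_from2 //.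
  apply: Rle_trans (@rsum_odd_prime_le f 1 k.+2 isT (fun i _ => f0 _)) _.
  apply: Rle_trans (rsum_if_le B k.+2 c0); apply: rsum_le => i _ _.
  rewrite /f; case: ifP => h; last by case: ifP => _; lra.
  rewrite ifT; first lra.
  rewrite -ltnS -ltn_double -(ltn_exp2r _ _ (isT : 0 < 3)%N).
  by apply: leq_ltn_trans B2; apply: leq_trans h; rewrite !expnS !expn0 /=; nia.
(* 227/1000 is what the coefficient 3 leaves after [4 ln 2], the cost of [2 theta]. *)
have hB : INR B * c <= 227 / 1000 * s + 7 * s / t.
  rewrite /c; have [cn|cp] := Rle_or_lt (t - ln 6) 0.
    by rewrite Rmax_left //; lra.
  rewrite Rmax_right; last lra.
  apply: cube_root_log_le => //; first exact: pos_INR.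
  by rewrite -INR_double -INR_expn; apply: INR_leq.
apply: Rle_trans (_ : \rsum_(0 <= q < k.+2.*2 | odd_prime q) (2 * ln (INR q) + f q) <= _); last first.
  have : s * (2 * ln 2) <= s * 1.3863 by apply: Rmult_le_compat_l; lra.
  by rewrite big_split /= rsum_scal; lra.
apply: rsum_le => q; rewrite mem_index_iota => /andP[_ hq] /andP[pq q2].
have qn : (q.-1 <= n)%N by nia.
have q3 : 3 <= INR q by rewrite -INR_3; apply: INR_leq.
have lq : ln 3 <= ln (INR q) by apply: ln_le; lra.
have l3 := ln3_bounds.
rewrite /f; case: ifP => h.
  have := nb_powers_ln_le q2 qn; rewrite -/t => hn.
  have -> : c = t - ln 6.
    rewrite /c Rmax_right //.
    suff : ln 6 <= t by lra.
    apply: ln_le; first lra.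
    have h18 : (18 <= n)%N by apply: leq_trans h; rewrite expnS expn1; nia.
    by have := INR_leq h18; rewrite (@INR_eq_IZR 18 18) //; lra.
  have : ln 6 + ln (3 / 2) = 2 * ln 3.
    rewrite -ln_mult; try lra.
    rewrite (_ : 6 * (3 / 2) = 3 * 3); last by field.
    by rewrite ln_mult; lra.
  lra.
rewrite Rplus_0_r; apply: Rmult_le_compat_r; first lra.
have := INR_leq (nb_powers_le2 (ltnW q2) qn _); apply.
by rewrite ltnNge h.
Qed.

(** [ln q / (q - 1)] is largest at [q = 3], where it equals [ln 3 / 2 < 0.55]; the tangent of [ln]
    at 3 replaces a monotonicity argument. *)
Lemma rsum_ln_div_le (k : nat) :
  \rsum_(0 <= q < k.+1.*2 | odd_prime q) (ln (INR q) / (INR q - 1)) <= INR k * 0.55.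
Proof.
have l3 := ln3_bounds.
rewrite rsum_odd_prime_from2 //.
have q3 i : (0 < i)%N -> 3 <= INR i.*2.+1 by move=> i0; rewrite -INR_3; apply: INR_leq; lia.
apply: Rle_trans (@rsum_odd_prime_le (fun q => ln (INR q) / (INR q - 1)) 1 k.+1 isT _) _.
  by move=> i /q3 h; apply: Rdiv_le_0_compat; [apply: ln_ge0|]; lra.
rewrite -rsum_const big_add1 /=; apply: rsum_le => i _ _.
have h := q3 i.+1 isT; set x := INR _ in h *.
have : ln (x / 3) <= x / 3 - 1 by apply: ln_le_sub1; lra.
rewrite ln_div; try lra.
by move=> h2; apply/Rle_div_l; lra.
Qed.

Section SmallPrimes.
Variables n k : nat.
Hypothesis n2 : (1 < n)%N.
Hypothesis hk : (k.*2 * k.*2.+1 <= n)%N.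

Let small_bounds (q : nat) : q \in index_iota 0 k.+1.*2 -> odd_prime q ->
  INR n * K_term q - INR (nb_powers n q) * ln (INR q) - ln (INR q) / (INR q - 1)
   <= INR (floor_gap n q) * ln (INR q)
   <= INR n * K_term q + INR (nb_powers n q) * ln (INR q).
Proof.
rewrite mem_index_iota => /andP[_ hq] oq; rewrite /K_term oq.
have /andP[pq q2] := oq.
have qn : (q.-1 <= n)%N by nia.
have q3 : 3 <= INR q by rewrite -INR_3; apply: INR_leq.
have lq : 0 <= ln (INR q) by apply: ln_ge0; lra.
have [h1 h2] := floor_gap_bounds (ltnW q2) qn; split.
  have := Rmult_le_compat_r _ _ _ lq h1.
  by rewrite /Rdiv; lra.
have := Rmult_le_compat_r _ _ _ lq h2.
by rewrite /Rdiv; lra.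
Qed.

Lemma rsum_small_gap_le :
  \rsum_(0 <= q < k.+1.*2 | odd_prime q) (INR (floor_gap n q) * ln (INR q))
   <= INR n * (\rsum_(0 <= q < k.+1.*2) K_term q)
      + (3 * sqrt (INR n) + 7 * sqrt (INR n) / ln (INR n) - 2 * ln 2).
Proof.
apply: Rle_trans (_ : \rsum_(0 <= q < k.+1.*2 | odd_prime q)
   (INR n * K_term q + INR (nb_powers n q) * ln (INR q)) <= _).
  by apply: rsum_le => q hq oq; case: (small_bounds hq oq).
rewrite big_split /=; apply: Rplus_le_compat; last exact: rsum_nb_powers_le.
rewrite rsum_scal; apply: Rmult_le_compat_l; first exact: pos_INR.
by apply: rsum_le_sub => // q _ _; exact: K_term_ge0.
Qed.

(** Unlike the upper bound, this one also pays the term [/ (q - 1)] of [floor_gap_bounds], summed by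
    [rsum_ln_div_le]. *)
Lemma rsum_small_gap_ge :
  INR n * (\rsum_(0 <= q < k.+1.*2) K_term q)
      - (3 * sqrt (INR n) + 7 * sqrt (INR n) / ln (INR n) - 2 * ln 2)
      - INR k * 0.55
   <= \rsum_(0 <= q < k.+1.*2 | odd_prime q) (INR (floor_gap n q) * ln (INR q)).
Proof.
apply: Rle_trans (_ : \rsum_(0 <= q < k.+1.*2 | odd_prime q)
   (INR n * K_term q + (- (INR (nb_powers n q) * ln (INR q))
     + - (ln (INR q) / (INR q - 1)))) <= _); last first.
  by apply: rsum_le => q hq oq; case: (small_bounds hq oq); lra.
rewrite !big_split /= !rsum_opp rsum_scal.
rewrite (_ : \rsum_(0 <= q < k.+1.*2) K_term q
  = \rsum_(0 <= q < k.+1.*2 | odd_prime q) K_term q); last first.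
  by rewrite [in RHS]big_mkcond; apply: eq_bigr => q _; rewrite /K_term; case: ifP.
have := rsum_nb_powers_le n2 hk; have := rsum_ln_div_le k; lra.
Qed.

End SmallPrimes.

(** * Assembly of the bounds on [ln (G n)] *)

Lemma ln_sqrt_2PI_bounds : 0.895 <= ln (sqrt (2 * PI)) <= 1.04.
Proof.
have p4 := PI_4; have p3 := PI2_3_2; have l2 := ln2_bounds; have l6 := ln6_ge.
have p0 : 0 < sqrt (2 * PI) by apply: sqrt_lt_R0; lra.
have e : 2 * ln (sqrt (2 * PI)) = ln (2 * PI).
  by rewrite -{2}[2 * PI]sqrt_sqrt; [rewrite ln_mult; lra|lra].
have : ln 6 <= ln (2 * PI) by apply: ln_le; lra.
have : ln (2 * PI) <= ln (2 * (2 * 2)) by apply: ln_le; lra.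
rewrite (ln_mult 2 (2 * 2)) ?(ln_mult 2 2); lra.
Qed.

(** The upper bound drops the tail of [K] and pays for the large primes; the lower bound drops the
    large primes and pays [n] times the tail. The two factorial bounds leave enough room for
    [ln (sqrt (2 * PI))] and the Stirling corrections to enter only through numerical estimates. *)
Lemma ln_G_bounds (n : nat) : (1 < n)%N -> 0.53 <= K ->
  - (1 / 2) * sqrt (INR n) * ln (INR n) - 4 * sqrt (INR n)
     - 7 * sqrt (INR n) / ln (INR n) - 5 / 4 * ln (INR n) + 1 / 2 * ln 2
     + ln (sqrt (2 * PI)) - K - 13 / 4 - 1 / ln (INR n)
     - ln (INR n) / (4 * sqrt (INR n)) - 1 / (4 * sqrt (INR n))
     + 1 / (12 * INR n + 1)
   <= ln (INR (G n)) - (INR n * ln (INR n) + INR n * (3 / 2 * ln 2 - 1 + K))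
   <= 1 / 2 * sqrt (INR n) * ln (INR n) + 4 * sqrt (INR n)
     + 7 * sqrt (INR n) / ln (INR n) + 1 / 2 * ln (INR n) + 3
     + ln (sqrt (2 * PI)) - ln 2 - 0.1250281 + 1 / ln (INR n)
     + 1 / (12 * INR n).
Proof.
move=> n2 hK; have l2 := ln2_bounds; have lp := ln_sqrt_2PI_bounds.
have n0 : (0 < n)%N by lia.
have nR : 2 <= INR n by apply: (INR_leq n2).
(* The cut is at [2k + 2]: odd [q] below it have [q (q - 1) <= 2k (2k + 1) <= n], and odd [q] above
   it have [q (q - 1) > n]. *)
have [k hk1 hk2] : exists2 k, (k.*2 * k.*2.+1 <= n)%N & (n < k.+1.*2 * k.+1.*2.+1)%N.
  have ex : exists k, (n < k.*2 * k.*2.+1)%N by exists n; nia.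
  case: (ex_minnP ex) => [[|k] hk mink]; first by lia.
  exists k => //; rewrite leqNgt; apply/negP => /mink; lia.
have kn : (k.+1.*2 <= n.+2)%N by case: k hk1 {hk2} => [|k]; nia.
have large := rsum_large_gap_le n0 hk2.
have small_u := rsum_small_gap_le n2 hk1.
have small_l := rsum_small_gap_ge n2 hk1.
have large_ge : 0 <= \rsum_(k.+1.*2 <= q < n.+2 | odd_prime q) (INR (floor_gap n q) * ln (INR q)).
  apply: rsum_ge0 => q _ /andP[/prime_gt0 q0 _].
  by apply: Rmult_le_pos; [exact: pos_INR | apply/ln_ge0/INR_ge1].
rewrite ln_G // (@big_cat_nat _ _ _ k.+1.*2) //=.
have fu := ln_fact_le n0; have fl := ln_fact_ge n0.
have [d1 d2] := @INR_div_bounds n 2 isT; rewrite (_ : INR 2 = 2) // in d1 d2.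
have d3 : INR n / 2 - / 2 <= INR (n %/ 2).
  have h : (n <= (n %/ 2).*2.+1)%N by lia.
  by have := INR_leq h; rewrite S_INR INR_double; lra.
have hd1 : INR (n %/ 2) * ln 2 <= INR n / 2 * ln 2 by apply: Rmult_le_compat_r; lra.
have hd2 : (INR n / 2 - / 2) * ln 2 <= INR (n %/ 2) * ln 2 by apply: Rmult_le_compat_r; lra.
have Kge := Rmult_le_compat_l (INR n) _ _ ltac:(lra) (K_ge k.+1.*2).
have Kle := Rmult_le_compat_l (INR n) _ _ ltac:(lra) (@K_le k.+1 isT).
set s := sqrt (INR n) in small_u small_l large *.
set t := ln (INR n) in small_u small_l large fu fl *.
have s2 : s * s = INR n by apply: sqrt_sqrt; lra.
have s14 : 1.414 <= s.
  rewrite -(sqrt_square 1.414); [apply: sqrt_le_1_alt|]; lra.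
have t2 : ln 2 <= t by apply: ln_le; lra.
have tp : 0 < / t by apply: Rinv_0_lt_compat; lra.
have sp : 0 < / s by apply: Rinv_0_lt_compat; lra.
have np : 0 < / INR n by apply: Rinv_0_lt_compat; lra.
split; last first.
  have e1 : 1 / (12 * INR n) = / 12 * / INR n by field; lra.
  rewrite e1 /(Rdiv 1 t); move: fu Kge small_u large hd1 lp l2; clear -tp np; lra.
have ks : INR k * 2 <= s.
  have h : (k.*2 ^ 2 <= n)%N by rewrite expnS expn1; nia.
  have := INR_leq h; rewrite INR_expn INR_double => h'.
  rewrite /s Rmult_comm -(sqrt_pow2 (2 * INR k)); last by have := pos_INR k; lra.
  exact: sqrt_le_1_alt.
have ls : ln s = t / 2 by rewrite /t -s2 ln_mult; lra.
(* With [u = 2k + 2], both [u <= s + 2] and [n <= (s + 3) (u - 1)] hold, so this cost is of order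
   [s t / 4]. *)
have tail : INR n * ((ln (2 * INR k.+1) + 3 / 2) / (2 * (2 * INR k.+1 - 1)))
    <= s * t / 4 + 3 / 4 * s + 3 / 4 * t + 13 / 4 + 3 * / s.
  have := INR_leq hk2; rewrite S_INR INR_mul S_INR INR_double => hu.
  have us : 2 * INR k.+1 <= s + 2 by rewrite S_INR; lra.
  have k1 : 1 <= INR k.+1 by apply: INR_ge1.
  have nu : INR n <= (s + 3) * (2 * INR k.+1 - 1).
    rewrite -s2 in hu *; case: (k) hu k1 => [|k'] hu k1.
      by rewrite [INR 1]/INR in hu *; nra.
    have : 2 <= INR k'.+2 by apply: (@INR_leq 2).
    move: hu; set u := INR _ => hu u2.
    have : s < 2 * u + / 2 by nra.
    nra.
  set u := 2 * INR k.+1 in us nu *.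
  have lu : ln u <= t / 2 + 2 * / s.
    apply: Rle_trans (_ : ln (s * (1 + 2 * / s)) <= _).
      apply: ln_le; first by rewrite /u; lra.
      by rewrite (_ : s * (1 + 2 * / s) = s + 2) //; field; lra.
    rewrite ln_mult; try lra.
    by have := @ln_le_sub1 (1 + 2 * / s) ltac:(lra); lra.
  have lu0 : 0 <= ln u by apply: ln_ge0; rewrite /u; lra.
  apply: Rle_trans (_ : (s + 3) * ((t / 2 + 2 * / s + 3 / 2) / 2) <= _); last first.
    rewrite (_ : (s + 3) * ((t / 2 + 2 * / s + 3 / 2) / 2) =
      s * t / 4 + 3 / 4 * s + 3 / 4 * t + 13 / 4 + 3 * / s); first lra.
    by field; lra.
  have -> : INR n * ((ln u + 3 / 2) / (2 * (u - 1))) = INR n / (u - 1) * ((ln u + 3 / 2) / 2).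
    by field; rewrite /u; lra.
  apply: Rmult_le_compat; try lra.
    by apply: Rdiv_le_0_compat; rewrite /u; lra.
  by apply/Rle_div_l => //; rewrite /u; lra.
have e1 : t / (4 * s) = / 4 * t * / s by field; lra.
have e2 : 1 / (4 * s) = / 4 * / s by field; lra.
have e3 : 1 / (12 * INR n + 1) <= 0.04.
  by apply/Rle_div_l; lra.
have ts : 0 < t * / s by apply: Rmult_lt_0_compat; lra.
(* What remains of the lower bound: 0.388 covers [1.04 + 0.04 - ln 2], from the bounds on
   [ln (sqrt (2 * PI))] and [1 / (12 n + 1)], and [0.025 s] is the excess of [3 + 0.275 + 3/4] over
   4. The case [n = 2] gets its own numerical values. *)
have fin : 3 * / s - 1 - s * t / 4 - / 2 * t + 0.025 * s - / t <= K - 0.388.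
  have [n3|n3] := leqP 3 n.
    have nR3 : 3 <= INR n by rewrite -INR_3; apply: INR_leq.
    have s17 : 1.732 <= s.
      rewrite -(sqrt_square 1.732); [apply: sqrt_le_1_alt|]; lra.
    have t3 : ln 3 <= t by apply: ln_le; lra.
    have l3 := ln3_bounds.
    have : / s <= / 1.732 by apply: Rinv_le_contravar; lra.
    have : s * 1.0986 <= s * t by apply: Rmult_le_compat_l; lra.
    lra.
  have n2' : INR n = 2 by rewrite (_ : n = 2%N) //; lia.
  have tl : t = ln 2 by rewrite /t n2'.
  have : / s <= / 1.414 by apply: Rinv_le_contravar; lra.
  have : / 0.693148 <= / t by rewrite tl; apply: Rinv_le_contravar; lra.
  have : 1.414 * 0.69314 <= s * t by apply: Rmult_le_compat; lra.
  have : s <= 1.5 by nra.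
  lra.
rewrite e1 e2 /(Rdiv 1 t).
lra.
Qed.

(** * Sums over primes and the zeta function *)

Definition zeta_term (s n : nat) : R := if n is 0%N then 0 else / INR n ^ s.

Lemma zeta_term_ge0 (s n : nat) : 0 <= zeta_term s n.
Proof.
case: n => [|n] /=; first lra.
by apply/Rlt_le/Rinv_0_lt_compat/pow_lt/INR_gt0.
Qed.

Lemma zeta_termM (s p n : nat) : (0 < p)%N ->
  zeta_term s (p * n) = / INR p ^ s * zeta_term s n.
Proof.
case: n => [|n] p0; first by rewrite muln0 /=; ring.
rewrite /zeta_term; case e: (p * n.+1)%N => [|m]; first by move: e; nia.
by rewrite -e INR_mul Rpow_mult_distr Rinv_mult.
Qed.

(** The terms of [- zeta'(s)]. *)
Definition log_term (s n : nat) : R := ln (INR n) * zeta_term s n.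

Lemma ln_INR_ge0 (n : nat) : (0 < n)%N -> 0 <= ln (INR n).
Proof. by move=> n0; apply/ln_ge0/INR_ge1. Qed.

Lemma log_term_ge0 (s n : nat) : 0 <= log_term s n.
Proof.
case: n => [|n]; first by rewrite /log_term /=; lra.
by apply: Rmult_le_pos; [exact: ln_INR_ge0 | exact: zeta_term_ge0].
Qed.

(** For prime [p] the sum over [n] is [zeta(s) / (p^s - 1)]; weighted by [ln p] and summed over all
    primes, this gives [- zeta'(s)]. *)
Definition val_term (s p n : nat) : R := INR (logn p n) * zeta_term s n.

Lemma val_term_ge0 (s p n : nat) : 0 <= val_term s p n.
Proof. by apply: Rmult_le_pos; [exact: pos_INR | exact: zeta_term_ge0]. Qed.

Lemma rsum_nat_le (a : nat -> R) (M N : nat) : (forall i, 0 <= a i) -> (M <= N)%N ->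
  \rsum_(0 <= i < M) a i <= \rsum_(0 <= i < N) a i.
Proof.
move=> a0 MN; rewrite [X in _ <= X](@big_cat_nat _ _ _ M) //=.
have : 0 <= \rsum_(M <= i < N) a i by apply: rsum_ge0 => *; exact: a0.
lra.
Qed.

Lemma rsum_multiples (a : nat -> R) (p M : nat) : (0 < p)%N ->
  (forall n, ~~ (p %| n) -> a n = 0) ->
  \rsum_(0 <= n < p * M) a n = \rsum_(0 <= m < M) a (p * m)%N.
Proof.
move=> p0 h; elim: M => [|M IH]; first by rewrite muln0 !big_geq.
rewrite mulnS addnC (@big_cat_nat _ _ _ (p * M)) //=; last by rewrite leq_addr.
rewrite IH [in RHS]big_nat_recr //=; congr (_ + _).
rewrite big_ltn; last by lia.
rewrite big1_seq ?Rplus_0_r // => n; rewrite mem_index_iota => /andP[_ hn].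
apply: h; apply/negP => /dvdnP[d e].
have dM : (M < d)%N by rewrite -(ltn_pmul2r p0) -e; lia.
have : (M.+1 * p <= d * p)%N by rewrite leq_mul2r dM orbT.
by rewrite mulSn; lia.
Qed.

(** Only multiples [n = p m] contribute, with valuation [1 + logn p m]. This is a finite form of
    [B = p^-s (zeta + B)]. *)
Lemma rsum_val_term (s p M : nat) : prime p ->
  \rsum_(0 <= n < p * M) val_term s p n
   = / INR p ^ s * (\rsum_(0 <= m < M) zeta_term s m + \rsum_(0 <= m < M) val_term s p m).
Proof.
move=> pp; have p0 := prime_gt0 pp; rewrite rsum_multiples //; last first.
  move=> n nd; rewrite /val_term lognE pp (negbTE nd) andbF [INR 0]/INR; ring.
rewrite -big_split -rsum_scal /=; apply: eq_bigr => m _.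
rewrite /val_term zeta_termM //; case: m => [|m]; first by rewrite /=; ring.
by rewrite lognM // -(expn1 p) pfactorK // expn1 plus_INR [INR 1]/INR; ring.
Qed.

Lemma prime_pow_gt1 (s p : nat) : (0 < s)%N -> prime p -> 1 < INR p ^ s.
Proof.
move=> s0 pp; rewrite -INR_expn; apply: (@INR_ltn 1).
by rewrite -(exp1n s) ltn_exp2r // prime_gt1.
Qed.

Section EulerProduct.
Variable s : nat.
Hypothesis s_gt0 : (0 < s)%N.
Hypothesis ex_zeta : ex_series (zeta_term s).

Let zeta := Series (zeta_term s).

(** A partial sum of [- zeta'(s) / zeta(s)]. *)
Definition prime_log_sum (N : nat) : R :=
  \rsum_(0 <= q < N | prime q) (ln (INR q) / (INR q ^ s - 1)).

(* The sum [b] over [n < M] is at most the sum [c] over [n < p M], and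
   [p^s c] is the zeta sum over [m < M] plus [b]. *)
Lemma rsum_val_term_le (p M : nat) : prime p ->
  \rsum_(0 <= n < M) val_term s p n <= zeta / (INR p ^ s - 1).
Proof.
move=> pp; have p1 := prime_pow_gt1 s_gt0 pp.
have le1 : \rsum_(0 <= n < M) val_term s p n <= \rsum_(0 <= n < p * M) val_term s p n.
  apply: rsum_nat_le; first exact: val_term_ge0.
  by rewrite leq_pmull // prime_gt0.
have zM := rsum_le_Series (@zeta_term_ge0 s) M ex_zeta; rewrite -/zeta in zM.
have := rsum_val_term s M pp; move: le1.
set b := \rsum_(0 <= n < M) _; set c := \rsum_(0 <= n < p * M) _ => bc e.
apply/Rle_div_r; first lra.
have : INR p ^ s * c = \rsum_(0 <= m < M) zeta_term s m + b by rewrite e; field; lra.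
nra.
Qed.

Lemma ex_series_val_term (p : nat) : prime p -> ex_series (val_term s p).
Proof.
move=> pp; apply: (ex_series_bounded (@val_term_ge0 s p)) => N; exact: rsum_val_term_le.
Qed.

(** Converse of [rsum_val_term_le] in the limit: each partial sum of [zeta_term + val_term] is [p^s]
    times a partial sum of [val_term], hence at most [p^s B]. *)
Lemma Series_val_term (p : nat) : prime p ->
  zeta / (INR p ^ s - 1) <= Series (val_term s p).
Proof.
move=> pp; have p1 := prime_pow_gt1 s_gt0 pp.
have eb := ex_series_val_term pp; set B := Series _.
apply/Rle_div_l; first lra.
suff : Series (fun n => zeta_term s n + val_term s p n) <= INR p ^ s * B.
  by rewrite Series_plus // -/zeta -/B; lra.
apply: Series_le_bound => [n|M].
  by have := zeta_term_ge0 s n; have := val_term_ge0 s p n; lra.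
have := rsum_le_Series (@val_term_ge0 s p) (p * M) eb; rewrite -/B rsum_val_term // -big_split /=.
move/(Rmult_le_compat_l (INR p ^ s) _ _ ltac:(lra)).
by rewrite -Rmult_assoc Rinv_r ?Rmult_1_l //; lra.
Qed.

Lemma ln_ge_prime_sum (n N : nat) : (0 < n)%N ->
  \rsum_(0 <= q < N | prime q) (INR (logn q n) * ln (INR q)) <= ln (INR n).
Proof.
move=> n0; rewrite (@ln_prime_sum n (N + n.+1)) //; last first.
  by move=> p pp /(dvdn_leq n0); lia.
rewrite [X in _ <= X](@big_cat_nat _ _ _ N) //=; last by lia.
have : 0 <= \rsum_(N <= q < N + n.+1 | prime q) (INR (logn q n) * ln (INR q)).
  apply: rsum_ge0 => q _ pq; apply: Rmult_le_pos; first exact: pos_INR.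
  exact/ln_INR_ge0/prime_gt0.
lra.
Qed.

Lemma is_series_prime_val (N : nat) :
  is_series (fun n => \rsum_(0 <= q < N | prime q) (ln (INR q) * val_term s q n))
    (\rsum_(0 <= q < N | prime q) (ln (INR q) * Series (val_term s q))).
Proof.
elim: N => [|N IH].
  rewrite big_geq //; apply: (is_series_ext (fun=> 0)) => [n|]; first by rewrite big_geq.
  have h := @is_lim_seq_const 0; apply: is_lim_seq_ext h => n.
  by rewrite sum_n_rsum big1.
rewrite big_mkcond big_nat_recr //= -big_mkcond.
apply: (is_series_ext (fun n => \rsum_(0 <= q < N | prime q) (ln (INR q) * val_term s q n)
   + (if prime N then ln (INR N) * val_term s N n else 0))).
  by move=> n; rewrite [in RHS]big_mkcond [in RHS]big_nat_recr //= -big_mkcond.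
apply: is_series_plus IH _; case: ifP => pN.
  by apply/is_series_scal_l/Series_correct/ex_series_val_term.
apply: is_lim_seq_ext (@is_lim_seq_const 0) => n.
by rewrite sum_n_rsum big1.
Qed.

(** [ln n] dominates the sum of [logn q n * ln q] over the primes [q < N]; weight by [n^-s], sum
    over [n] and interchange. *)
Lemma prime_log_sum_le (A : R) (N : nat) :
  (forall M, \rsum_(0 <= n < M) log_term s n <= A) -> zeta * prime_log_sum N <= A.
Proof.
move=> hA.
apply: Rle_trans (_ : \rsum_(0 <= q < N | prime q) (ln (INR q) * Series (val_term s q)) <= _).
  rewrite /prime_log_sum -rsum_scal; apply: rsum_le => q _ pq.
  have := Rmult_le_compat_l _ _ _ (ln_INR_ge0 (prime_gt0 pq)) (Series_val_term pq).
  by rewrite /Rdiv; lra.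
rewrite -(is_series_unique _ _ (@is_series_prime_val N)).
have t0 n : 0 <= \rsum_(0 <= q < N | prime q) (ln (INR q) * val_term s q n).
  apply: rsum_ge0 => q _ pq; apply: Rmult_le_pos (val_term_ge0 _ _ _).
  exact/ln_INR_ge0/prime_gt0.
apply: (Series_le_bound t0) => M; apply: Rle_trans (hA M); apply: rsum_le => n _ _.
case: n => [|n].
  rewrite big1; first by rewrite /log_term /=; lra.
  by move=> q _; rewrite /val_term /=; ring.
have h := @ln_ge_prime_sum n.+1 N isT.
apply: Rle_trans (Rmult_le_compat_r _ _ _ (zeta_term_ge0 s n.+1) h).
rewrite Rmult_comm -rsum_scal; apply: Req_le; apply: eq_bigr => q _.
by rewrite /val_term; ring.
Qed.

(** For [0 < n < N] all prime factors of [n] lie below [N], so [ln n] is exactly its sum over the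
    primes [q < N]; the partial sums of [val_term] are then replaced by their upper bound. *)
Lemma prime_log_sum_ge (N : nat) :
  \rsum_(0 <= n < N) log_term s n <= zeta * prime_log_sum N.
Proof.
apply: Rle_trans (_ : \rsum_(0 <= q < N | prime q)
  (ln (INR q) * (\rsum_(0 <= n < N) val_term s q n)) <= _); last first.
  rewrite /prime_log_sum -rsum_scal; apply: rsum_le => q _ pq.
  apply: Rle_trans (Rmult_le_compat_l _ _ _ (ln_INR_ge0 (prime_gt0 pq)) (rsum_val_term_le N pq)) _.
  by apply: Req_le; rewrite /Rdiv; ring.
rewrite [X in _ <= X](eq_bigr (fun q => \rsum_(0 <= n < N) (ln (INR q) * val_term s q n))); last first.
  by move=> q _; rewrite rsum_scal.
rewrite [X in _ <= X]exchange_big /=; apply: rsum_le => n; rewrite mem_index_iota => /andP[_ hn] _.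
case: n hn => [|n] hn.
  rewrite big1; first by rewrite /log_term /=; lra.
  by move=> q _; rewrite /val_term /=; ring.
rewrite /log_term (@ln_prime_sum n.+1 N) //; last by move=> p _ /dvdn_leq; lia.
rewrite Rmult_comm -rsum_scal; apply: Req_le; apply: eq_bigr => q _.
by rewrite /val_term; ring.
Qed.

End EulerProduct.

(** * Tails by the Hermite-Hadamard inequality *)

Section HermiteHadamard.
Variables (F f g : R -> R) (a : R).
Hypothesis dF : forall x, a <= x -> is_derive F x (- f x).
Hypothesis df : forall x, a <= x -> is_derive f x (g x).
Hypothesis g_incr : forall x y, a <= x -> x <= y -> g x <= g y.

(** [F x - F y] is the integral of [f] from [x] to [y], and [f] is convex because [g] increases. The
    two sides are compared as functions of the half-width [h], which requires derivatives only. *)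
Lemma midpoint_le (x : R) : a <= x - / 2 -> f x <= F (x - / 2) - F (x + / 2).
Proof.
move=> ax.
have conv h : 0 <= h <= / 2 -> 2 * f x <= f (x - h) + f (x + h).
  move=> hh; pose psi h := f (x - h) + f (x + h).
  have : psi 0 <= psi h.
    apply: (@le_of_derive_ge0 psi (fun h => g (x + h) - g (x - h))); first by lra.
      move=> y hy; rewrite /psi; auto_derive.
        by split; [|split => //]; eexists; apply: df; lra.
      rewrite (is_derive_unique _ _ _ (df (_ : a <= x + - y))); last lra.
      rewrite (is_derive_unique _ _ _ (df (_ : a <= x + y))); last lra.
      by rewrite /Rminus; ring.
    by move=> y hy; have := @g_incr (x - y) (x + y) ltac:(lra) ltac:(lra); lra.
  by rewrite /psi Rminus_0_r Rplus_0_r; lra.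
pose phi h := F (x - h) - F (x + h) - 2 * h * f x.
have : phi 0 <= phi (/ 2).
  apply: (@le_of_derive_ge0 phi (fun h => f (x - h) + f (x + h) - 2 * f x)); first by lra.
    move=> y hy; rewrite /phi; auto_derive.
      by split; [|split => //]; eexists; apply: dF; lra.
    rewrite (is_derive_unique _ _ _ (dF (_ : a <= x + - y))); last lra.
    rewrite (is_derive_unique _ _ _ (dF (_ : a <= x + y))); last lra.
    by rewrite /Rminus; ring.
  by move=> y hy; have := conv y hy; lra.
by rewrite /phi Rminus_0_r Rplus_0_r; lra.
Qed.

(** Comparison as functions of the width [h]: the difference increases because the tangent of the
    convex [f] at [x + h] stays below [f x]. *)
Lemma trapezoid_ge (x : R) : a <= x -> F x - F (x + 1) <= (f x + f (x + 1)) / 2.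
Proof.
move=> ax.
have tangent h : 0 <= h <= 1 -> 0 <= f x - f (x + h) + h * g (x + h).
  move=> hh; pose chi y := y * g (x + h) - f (x + y).
  have : chi 0 <= chi h.
    apply: (@le_of_derive_ge0 chi (fun y => g (x + h) - g (x + y))); first by lra.
      move=> y hy; rewrite /chi; auto_derive; first by eexists; apply: df; lra.
      by rewrite (is_derive_unique _ _ _ (df (_ : a <= x + y))); [ring | lra].
    by move=> y hy; have := @g_incr (x + y) (x + h) ltac:(lra) ltac:(lra); lra.
  by rewrite /chi Rplus_0_r; lra.
pose phi h := h * (f x + f (x + h)) - 2 * (F x - F (x + h)).
have : phi 0 <= phi 1.
  apply: (@le_of_derive_ge0 phi (fun h => f x - f (x + h) + h * g (x + h))); first by lra.
    move=> y hy; rewrite /phi; auto_derive.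
      by split; [eexists; apply: df; lra | split => //]; eexists; apply: dF; lra.
    rewrite (is_derive_unique _ _ _ (df (_ : a <= x + y))); last lra.
    rewrite (is_derive_unique _ _ _ (dF (_ : a <= x + y))); last lra.
    by ring.
  by move=> y hy; have := tangent y hy.
by rewrite /phi Rplus_0_r; lra.
Qed.

Variables (u : nat -> R) (N : nat).
Hypothesis N_ge : a <= INR N - / 2.
Hypothesis uE : forall n, (N <= n)%N -> u n = f (INR n).
Hypothesis u_ge0 : forall n, 0 <= u n.
Hypothesis F_ge0 : forall x, a <= x -> 0 <= F x.
(** One crude rate fitting all four instances; it only has to vanish at infinity. *)
Hypothesis decay : forall x, a <= x -> F x + f x / 2 <= 4 / sqrt x.

(** The unit intervals centred at the integers [n >= N] tile the half-line from [N - 1/2]. *)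
Lemma rsum_upper (M : nat) :
  \rsum_(0 <= n < M) u n <= \rsum_(0 <= n < N) u n + F (INR N - / 2).
Proof.
apply: Rle_trans (rsum_nat_le u_ge0 (leq_addl N M)) _.
rewrite (@big_cat_nat _ _ _ N) //=; last by rewrite leq_addr.
apply: Rplus_le_compat_l.
suff h d : \rsum_(N <= n < N + d) u n <= F (INR N - / 2) - F (INR (N + d) - / 2).
  have := h M; have := @F_ge0 (INR (N + M) - / 2); have := INR_leq (leq_addr M N).
  lra.
elim: d => [|d IH]; first by rewrite addn0 big_geq //; lra.
have Nd := INR_leq (leq_addr d N).
rewrite addnS big_nat_recr /=; last by rewrite leq_addr.
rewrite uE ?leq_addr // S_INR.
have := @midpoint_le (INR (N + d)) ltac:(lra).
rewrite (_ : INR (N + d) + 1 - / 2 = INR (N + d) + / 2); [lra | field].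
Qed.

(** Adding trapezoids counts the first term half, hence the extra [f N / 2]; at the far end [decay]
    absorbs [F] and half of [f]. *)
Lemma rsum_lower (M : nat) : (N <= M)%N ->
  \rsum_(0 <= n < N) u n + F (INR N) + f (INR N) / 2 - 4 / sqrt (INR M)
    <= \rsum_(0 <= n < M) u n.
Proof.
move=> NM; rewrite [X in _ <= X](@big_cat_nat _ _ _ N) //= -(subnKC NM).
suff h d : F (INR N) - F (INR (N + d)) + (f (INR N) - f (INR (N + d))) / 2
    <= \rsum_(N <= n < N + d) u n.
  have := h (M - N)%N; have := @decay (INR (N + (M - N))); have := INR_leq (leq_addr (M - N) N).
  lra.
elim: d => [|d IH]; first by rewrite addn0 big_geq //; lra.
have Nd := INR_leq (leq_addr d N).
rewrite addnS [X in _ <= X]big_nat_recr /=; last by rewrite leq_addr.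
rewrite uE ?leq_addr // S_INR.
by have := @trapezoid_ge (INR (N + d)) ltac:(lra); lra.
Qed.

End HermiteHadamard.

(** The passage to the limit in [M], by the Archimedean property. *)
Lemma le_of_sqrt_decay (L C c : R) (N : nat) : 0 <= c ->
  (forall M, (N <= M)%N -> L - c / sqrt (INR M) <= C) -> L <= C.
Proof.
move=> c0 h; apply: Rnot_lt_le => CL.
have [M hM] := INR_unbounded (((c + 1) / (L - C)) ^ 2).
have p : 0 < (c + 1) / (L - C) by apply: Rdiv_lt_0_compat; lra.
have hM' : ((c + 1) / (L - C)) ^ 2 < INR (N + M).
  by have := INR_leq (leq_addl N M); lra.
have sM : (c + 1) / (L - C) < sqrt (INR (N + M)).
  by rewrite -(sqrt_pow2 ((c + 1) / (L - C))); [apply: sqrt_lt_1_alt; split; [apply: pow2_ge_0|] | lra].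
have := h _ (leq_addr M N).
have : c / sqrt (INR (N + M)) < L - C.
  apply/Rlt_div_l; first lra.
  have := Rmult_lt_compat_l (L - C) _ _ ltac:(lra) sM.
  by rewrite (_ : (L - C) * ((c + 1) / (L - C)) = c + 1); [lra | field; lra].
lra.
Qed.

(** * Tail bounds for zeta and its derivative at 2 and 3 *)

Lemma ln_le_2sqrt (x : R) : 1 <= x -> ln x <= 2 * sqrt x.
Proof.
move=> x1; have s0 : 0 < sqrt x by apply: sqrt_lt_R0; lra.
have -> : ln x = 2 * ln (sqrt x) by rewrite -{1}(sqrt_sqrt x) ?ln_mult; lra.
by have := ln_le_sub1 s0; lra.
Qed.

Lemma ln_ge1 (x : R) : 3 <= x -> 1 <= ln x.
Proof.
move=> x3; have : ln 3 <= ln x by apply: ln_le; lra.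
by have := ln3_bounds; lra.
Qed.

Lemma incr_of_derive (g g' : R -> R) (a : R) :
  (forall x, a <= x -> is_derive g x (g' x)) -> (forall x, a <= x -> 0 <= g' x) ->
  forall x y, a <= x -> x <= y -> g x <= g y.
Proof.
move=> dg g0 x y ax xy; apply: (@le_of_derive_ge0 g g') => // z hz.
  by apply: dg; lra.
by apply: g0; lra.
Qed.

(** In terms of [w = / sqrt x] the decay estimates become polynomial, with [ln x] controlled through
    [ln x * w <= 2]. *)
Lemma inv_sqrt_facts (x : R) : 3 <= x ->
  [/\ 0 < / sqrt x <= 1, / x = (/ sqrt x) ^ 2 & 0 <= ln x * / sqrt x <= 2].
Proof.
move=> x3; have s1 : 1 <= sqrt x by rewrite -sqrt_1; apply: sqrt_le_1_alt; lra.
have i0 : 0 < / sqrt x by apply: Rinv_0_lt_compat; lra.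
split.
- by split=> //; rewrite -Rinv_1; apply: Rinv_le_contravar; lra.
- by rewrite pow_inv -Rsqr_pow2 Rsqr_sqrt //; lra.
split; first by apply: Rmult_le_pos; [have := ln_ge1 x3|]; lra.
have := Rmult_le_compat_r (/ sqrt x) _ _ ltac:(lra) (@ln_le_2sqrt x ltac:(lra)).
by rewrite Rmult_assoc Rinv_r; lra.
Qed.

Lemma pow_le_anti (w : R) (i j : nat) : 0 <= w <= 1 -> (i <= j)%N -> w ^ j <= w ^ i.
Proof.
move=> w01 ij; rewrite -(subnKC ij) pow_add -[X in _ <= X]Rmult_1_r.
apply: Rmult_le_compat_l; first by apply: pow_le; lra.
by rewrite -(pow1 (j - i)); apply: pow_incr.
Qed.

Section Instances.
Variable N : nat.
Hypothesis N_ge : (4 <= N)%N.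

(** All instances live on the half-line from 3, where [ln x >= 1] makes the second derivatives of
    [ln x / x^2] and [ln x / x^3] nonnegative. *)
Let N_half : 3 <= INR N - / 2.
Proof. by have := INR_leq N_ge; rewrite (@INR_eq_IZR 4 4) //; lra. Qed.

Lemma zeta_termE (s n : nat) : (N <= n)%N -> zeta_term s n = / INR n ^ s.
Proof. by case: n => //; move: N_ge; lia. Qed.

Lemma log_termE (s n : nat) : (N <= n)%N -> log_term s n = ln (INR n) / INR n ^ s.
Proof. by move=> h; rewrite /log_term zeta_termE. Qed.

Ltac derive_tac := move=> x x3; auto_derive;
  [repeat split; solve [lra | apply: pow_nonzero; lra | apply: Rmult_integral_contrapositive_currified; [lra | apply: pow_nonzero; lra]]
  | rewrite /INR; field; lra].

Lemma zeta2_tail : (forall M, \rsum_(0 <= n < M) zeta_term 2 n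
     <= \rsum_(0 <= n < N) zeta_term 2 n + / (INR N - / 2)) /\
  (forall M, (N <= M)%N ->
    \rsum_(0 <= n < N) zeta_term 2 n + / INR N + / INR N ^ 2 / 2 - 4 / sqrt (INR M)
      <= \rsum_(0 <= n < M) zeta_term 2 n).
Proof.
pose F (x : R) := / x; pose f (x : R) := / x ^ 2; pose g (x : R) := - 2 / x ^ 3.
have dF : forall x, 3 <= x -> is_derive F x (- f x) by rewrite /F /f; derive_tac.
have df : forall x, 3 <= x -> is_derive f x (g x) by rewrite /f /g; derive_tac.
have dg : forall x, 3 <= x -> is_derive g x (6 / x ^ 4) by rewrite /g; derive_tac.
have gi : forall x y, 3 <= x -> x <= y -> g x <= g y.
  apply: (incr_of_derive dg) => x x3; have := ln_ge1 x3 => lx.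
  by apply: Rdiv_le_0_compat; [lra | apply: pow_lt; lra].
have F0 x : 3 <= x -> 0 <= F x.
  move=> x3; have lx := ln_ge1 x3; rewrite /F.
  by apply/Rlt_le/Rinv_0_lt_compat; lra.
have dec x : 3 <= x -> F x + f x / 2 <= 4 / sqrt x.
  move=> x3; have [w01 e lw] := inv_sqrt_facts x3; move: w01 e lw.
  rewrite /Rdiv; set w := / sqrt x; set l := ln x => w01 e lw.
  have -> : F x + f x * / 2 = w ^ 2 + w ^ 4 / 2 by rewrite /F /f -pow_inv e; field.
  have : w ^ 2 <= w by rewrite -{2}[w]pow_1; apply: pow_le_anti; [lra|].
  have : w ^ 4 <= w ^ 2 by apply: pow_le_anti; [lra|].
  lra.
have uE n : (N <= n)%N -> zeta_term 2 n = f (INR n) by move=> h; rewrite zeta_termE.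
split=> M; [exact: (rsum_upper dF df gi N_half uE (@zeta_term_ge0 2) F0)
           | exact: (rsum_lower dF df gi N_half uE dec)].
Qed.

Lemma zeta3_tail : (forall M, \rsum_(0 <= n < M) zeta_term 3 n
     <= \rsum_(0 <= n < N) zeta_term 3 n + / (INR N - / 2) ^ 2 / 2) /\
  (forall M, (N <= M)%N ->
    \rsum_(0 <= n < N) zeta_term 3 n + / INR N ^ 2 / 2 + / INR N ^ 3 / 2 - 4 / sqrt (INR M)
      <= \rsum_(0 <= n < M) zeta_term 3 n).
Proof.
pose F (x : R) := / x ^ 2 / 2; pose f (x : R) := / x ^ 3; pose g (x : R) := - 3 / x ^ 4.
have dF : forall x, 3 <= x -> is_derive F x (- f x) by rewrite /F /f; derive_tac.
have df : forall x, 3 <= x -> is_derive f x (g x) by rewrite /f /g; derive_tac.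
have dg : forall x, 3 <= x -> is_derive g x (12 / x ^ 5) by rewrite /g; derive_tac.
have gi : forall x y, 3 <= x -> x <= y -> g x <= g y.
  apply: (incr_of_derive dg) => x x3; have := ln_ge1 x3 => lx.
  by apply: Rdiv_le_0_compat; [lra | apply: pow_lt; lra].
have F0 x : 3 <= x -> 0 <= F x.
  move=> x3; have lx := ln_ge1 x3; rewrite /F.
  by apply: Rdiv_le_0_compat; [apply/Rlt_le/Rinv_0_lt_compat/pow_lt|]; lra.
have dec x : 3 <= x -> F x + f x / 2 <= 4 / sqrt x.
  move=> x3; have [w01 e lw] := inv_sqrt_facts x3; move: w01 e lw.
  rewrite /Rdiv; set w := / sqrt x; set l := ln x => w01 e lw.
  have -> : F x + f x * / 2 = w ^ 4 / 2 + w ^ 6 / 2 by rewrite /F /f -!pow_inv e; field.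
  have : w ^ 2 <= w by rewrite -{2}[w]pow_1; apply: pow_le_anti; [lra|].
  have : w ^ 4 <= w ^ 2 by apply: pow_le_anti; [lra|].
  have : w ^ 6 <= w ^ 4 by apply: pow_le_anti; [lra|].
  lra.
have uE n : (N <= n)%N -> zeta_term 3 n = f (INR n) by move=> h; rewrite zeta_termE.
split=> M; [exact: (rsum_upper dF df gi N_half uE (@zeta_term_ge0 3) F0)
           | exact: (rsum_lower dF df gi N_half uE dec)].
Qed.

Lemma log2_tail : (forall M, \rsum_(0 <= n < M) log_term 2 n
     <= \rsum_(0 <= n < N) log_term 2 n + (ln (INR N - / 2) + 1) / (INR N - / 2)) /\
  (forall M, (N <= M)%N ->
    \rsum_(0 <= n < N) log_term 2 n + (ln (INR N) + 1) / INR N + (ln (INR N) / INR N ^ 2) / 2 - 4 / sqrt (INR M)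
      <= \rsum_(0 <= n < M) log_term 2 n).
Proof.
pose F (x : R) := (ln x + 1) / x; pose f (x : R) := ln x / x ^ 2; pose g (x : R) := (1 - 2 * ln x) / x ^ 3.
have dF : forall x, 3 <= x -> is_derive F x (- f x) by rewrite /F /f; derive_tac.
have df : forall x, 3 <= x -> is_derive f x (g x) by rewrite /f /g; derive_tac.
have dg : forall x, 3 <= x -> is_derive g x ((6 * ln x - 5) / x ^ 4) by rewrite /g; derive_tac.
have gi : forall x y, 3 <= x -> x <= y -> g x <= g y.
  apply: (incr_of_derive dg) => x x3; have := ln_ge1 x3 => lx.
  by apply: Rdiv_le_0_compat; [lra | apply: pow_lt; lra].
have F0 x : 3 <= x -> 0 <= F x.
  move=> x3; have lx := ln_ge1 x3; rewrite /F.
  by apply: Rdiv_le_0_compat; lra.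
have dec x : 3 <= x -> F x + f x / 2 <= 4 / sqrt x.
  move=> x3; have [w01 e lw] := inv_sqrt_facts x3; move: w01 e lw.
  rewrite /Rdiv; set w := / sqrt x; set l := ln x => w01 e lw.
  have -> : F x + f x * / 2 = l * w * w + w ^ 2 + l * w * w ^ 3 / 2.
    by rewrite /F /f /Rdiv -!pow_inv e -/l; field.
  have : w ^ 2 <= w by rewrite -{2}[w]pow_1; apply: pow_le_anti; [lra|].
  have : w ^ 3 <= w by rewrite -{2}[w]pow_1; apply: pow_le_anti; [lra|].
  have : l * w * w <= 2 * w by nra.
  have : l * w * w ^ 3 <= 2 * w ^ 3 by apply: Rmult_le_compat_r; [apply: pow_le|]; lra.
  lra.
have uE n : (N <= n)%N -> log_term 2 n = f (INR n) by move=> h; rewrite log_termE.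
split=> M; [exact: (rsum_upper dF df gi N_half uE (@log_term_ge0 2) F0)
           | exact: (rsum_lower dF df gi N_half uE dec)].
Qed.

Lemma log3_tail : (forall M, \rsum_(0 <= n < M) log_term 3 n
     <= \rsum_(0 <= n < N) log_term 3 n + (2 * ln (INR N - / 2) + 1) / (4 * (INR N - / 2) ^ 2)) /\
  (forall M, (N <= M)%N ->
    \rsum_(0 <= n < N) log_term 3 n + (2 * ln (INR N) + 1) / (4 * INR N ^ 2) + (ln (INR N) / INR N ^ 3) / 2 - 4 / sqrt (INR M)
      <= \rsum_(0 <= n < M) log_term 3 n).
Proof.
pose F (x : R) := (2 * ln x + 1) / (4 * x ^ 2); pose f (x : R) := ln x / x ^ 3; pose g (x : R) := (1 - 3 * ln x) / x ^ 4.
have dF : forall x, 3 <= x -> is_derive F x (- f x) by rewrite /F /f; derive_tac.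
have df : forall x, 3 <= x -> is_derive f x (g x) by rewrite /f /g; derive_tac.
have dg : forall x, 3 <= x -> is_derive g x ((12 * ln x - 7) / x ^ 5) by rewrite /g; derive_tac.
have gi : forall x y, 3 <= x -> x <= y -> g x <= g y.
  apply: (incr_of_derive dg) => x x3; have := ln_ge1 x3 => lx.
  by apply: Rdiv_le_0_compat; [lra | apply: pow_lt; lra].
have F0 x : 3 <= x -> 0 <= F x.
  move=> x3; have lx := ln_ge1 x3; rewrite /F.
  by apply: Rdiv_le_0_compat; [|have : 0 < x ^ 2 by apply: pow_lt; lra]; lra.
have dec x : 3 <= x -> F x + f x / 2 <= 4 / sqrt x.
  move=> x3; have [w01 e lw] := inv_sqrt_facts x3; move: w01 e lw.
  rewrite /Rdiv; set w := / sqrt x; set l := ln x => w01 e lw.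
  have -> : F x + f x * / 2 = l * w * w ^ 3 / 2 + w ^ 4 / 4 + l * w * w ^ 5 / 2.
    by rewrite /F /f /Rdiv Rinv_mult -!pow_inv e -/l; field.
  have : w ^ 3 <= w by rewrite -{2}[w]pow_1; apply: pow_le_anti; [lra|].
  have : w ^ 4 <= w ^ 3 by apply: pow_le_anti; [lra|].
  have : w ^ 5 <= w ^ 3 by apply: pow_le_anti; [lra|].
  have : l * w * w ^ 3 <= 2 * w ^ 3 by apply: Rmult_le_compat_r; [apply: pow_le|]; lra.
  have : l * w * w ^ 5 <= 2 * w ^ 5 by apply: Rmult_le_compat_r; [apply: pow_le|]; lra.
  lra.
have uE n : (N <= n)%N -> log_term 3 n = f (INR n) by move=> h; rewrite log_termE.
split=> M; [exact: (rsum_upper dF df gi N_half uE (@log_term_ge0 3) F0)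
           | exact: (rsum_lower dF df gi N_half uE dec)].
Qed.

End Instances.

(** * The numerical value of [K] *)

Fixpoint inv_pow_sum (dv : Z -> Z -> Z) (s : Z) (k : nat) : Z :=
  if k is k'.+1 then (inv_pow_sum dv s k' + dv fx_scale (Z.of_nat k ^ s))%Z else 0%Z.

Lemma inv_pow_sum_bounds (s k : nat) :
  IZR (inv_pow_sum Z.div (Z.of_nat s) k)
   <= IZR fx_scale * (\rsum_(0 <= n < k.+1) zeta_term s n)
   <= IZR (inv_pow_sum cdiv (Z.of_nat s) k).
Proof.
elim: k => [|k IH]; first by rewrite big_nat1 /=; lra.
have p0 : (0 < Z.of_nat k.+1 ^ Z.of_nat s)%Z by apply: Z.pow_pos_nonneg; lia.
rewrite big_nat_recr //= !plus_IZR.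
have l := IZR_div_le fx_scale p0; have u := IZR_cdiv_ge fx_scale p0.
move: l u; rewrite -pow_IZR -INR_IZR_INZ /Rdiv; lra.
Qed.

Lemma zeta_sum_fx (s k : nat) (a b : Z) :
  ((a <=? inv_pow_sum Z.div (Z.of_nat s) k) && (inv_pow_sum cdiv (Z.of_nat s) k <=? b))%Z ->
  IZR a / 10 ^ 13 <= \rsum_(0 <= n < k.+1) zeta_term s n <= IZR b / 10 ^ 13.
Proof.
have S0 := fx_scale_gt0; rewrite -!IZR_div_scale.
move=> /andP[/Z.leb_le/IZR_le ha /Z.leb_le/IZR_le hb].
have := inv_pow_sum_bounds s k.
by split; [apply/Rle_div_l | apply/Rle_div_r]; lra.
Qed.

Lemma ln_wsum_fx (num den : nat -> Z) (k : nat) (a b : Z) :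
  (forall i, (0 < i)%N -> (0 <= num i)%Z) -> (forall i, (1 < i)%N -> (0 < den i)%Z) ->
  ((a <=? (ln_wsum ln_step_lo Z.div num den k).2) &&
   ((ln_wsum ln_step_hi cdiv num den k).2 <=? b))%Z ->
  IZR a / 10 ^ 13 <= \rsum_(1 <= i < k.+2) (IZR (num i) / IZR (den i) * ln (INR i))
   <= IZR b / 10 ^ 13.
Proof.
move=> n0 d0; have S0 := fx_scale_gt0; rewrite -!IZR_div_scale.
move=> /andP[/Z.leb_le/IZR_le ha /Z.leb_le/IZR_le hb].
have [_ h1] := ln_wsum_lo n0 d0 k; have [_ h2] := ln_wsum_hi n0 d0 k.
by split; [apply/Rle_div_l | apply/Rle_div_r]; lra.
Qed.

Definition log_den (s : Z) (i : nat) : Z := (Z.of_nat i ^ s)%Z.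
Definition rem_num (i : nat) : Z := if odd_prime i then (2 * (Z.of_nat i + 2))%Z else 0%Z.
Definition rem_den (i : nat) : Z :=
  let q := Z.of_nat i in ((q - 1) ^ 2 * (q + 1) * (q ^ 2 + q + 1))%Z.


Lemma log_sum_fx (s k : nat) (a b : Z) :
  ((a <=? (ln_wsum ln_step_lo Z.div (fun=> 1) (log_den (Z.of_nat s)) k).2) &&
   ((ln_wsum ln_step_hi cdiv (fun=> 1) (log_den (Z.of_nat s)) k).2 <=? b))%Z ->
  IZR a / 10 ^ 13 <= \rsum_(0 <= n < k.+2) log_term s n <= IZR b / 10 ^ 13.
Proof.
move=> c; rewrite big_ltn // (_ : log_term s 0 = 0) ?Rplus_0_l; last by rewrite /log_term /=; ring.
rewrite (eq_big_nat _ _ (F2 := fun i => IZR 1 / IZR (log_den (Z.of_nat s) i) * ln (INR i))).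
  by apply: ln_wsum_fx c => // i i1; apply: Z.pow_pos_nonneg; lia.
move=> [|i] // _; rewrite /log_term /log_den /= -pow_IZR -INR_IZR_INZ.
by rewrite /Rdiv; ring.
Qed.

(** What is left of [1 / (q - 1)^2] after [1 / (q^2 - 1)] and [2 / (q^3 - 1)]; it behaves like
    [2 / q^4]. *)
Definition rem_weight (q : nat) : R :=
  2 * (INR q + 2) / ((INR q - 1) ^ 2 * (INR q + 1) * (INR q ^ 2 + INR q + 1)).

Lemma rem_sum_fx (k : nat) (a b : Z) :
  ((a <=? (ln_wsum ln_step_lo Z.div rem_num rem_den k).2) &&
   ((ln_wsum ln_step_hi cdiv rem_num rem_den k).2 <=? b))%Z ->
  IZR a / 10 ^ 13
   <= \rsum_(0 <= q < k.+2 | odd_prime q) (ln (INR q) * rem_weight q)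
   <= IZR b / 10 ^ 13.
Proof.
move=> c; rewrite big_mkcond big_ltn //= Rplus_0_l.
rewrite (eq_big_nat _ _ (F2 := fun i => IZR (rem_num i) / IZR (rem_den i) * ln (INR i))).
  apply: ln_wsum_fx c => i i1; first by rewrite /rem_num; case: ifP; lia.
  by rewrite /rem_den; nia.
move=> i _; rewrite /rem_num; case: ifP => _; last by rewrite /Rdiv; ring.
rewrite /rem_den /rem_weight !(mult_IZR, plus_IZR, minus_IZR) -INR_IZR_INZ.
by rewrite /pow /Rdiv !Rmult_1_r; ring.
Qed.

Lemma rem_weight_ge0 (q : nat) : (1 < q)%N -> 0 <= rem_weight q.
Proof.
move=> q1; have := INR_leq q1; rewrite (@INR_eq_IZR 2 2) // => q2.
rewrite /rem_weight; apply: Rdiv_le_0_compat; first lra.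
apply: Rmult_lt_0_compat; last by nra.
by apply: Rmult_lt_0_compat; [apply: pow_lt|]; lra.
Qed.

Lemma ln400_bounds : 5.9914645460749 <= ln 400 <= 5.9914645471796.
Proof.
suff : IZR 59914645460749 / 10 ^ 13 <= ln (INR 400) <= IZR 59914645471796 / 10 ^ 13.
  by rewrite (@INR_eq_IZR 400 400) //; lra.
apply: (@ln_fx_bounds 399); vm_cast_no_check (erefl true).
Qed.

Lemma rem_tail_le (N M : nat) : (400 <= N)%N ->
  \rsum_(0 <= q < M | odd_prime q) (ln (INR q) * rem_weight q)
   <= \rsum_(0 <= q < N | odd_prime q) (ln (INR q) * rem_weight q) + 0.000000095.
Proof.
move=> hN; pose u q := if odd_prime q then ln (INR q) * rem_weight q else 0.
have uE m p : \rsum_(m <= q < p | odd_prime q) (ln (INR q) * rem_weight q) = \rsum_(m <= q < p) u q.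
  by rewrite big_mkcond.
have u0 q : 0 <= u q.
  rewrite /u; case: ifP => [/andP[/prime_gt1 q1 _]|_]; last lra.
  by apply: Rmult_le_pos; [apply: ln_INR_ge0; lia | exact: rem_weight_ge0].
have l400 : ln 400 <= 5.9915.
  by have := ln400_bounds; lra.
(* A telescoping majorant, unrelated to the arithmetic [G]; its value at 400 is below
   [9.5 * 10^-8]. *)
pose G x := (3 / 200) / ((x - 1) * (x - 2)).
have step q : (400 <= q)%N -> u q <= G (INR q) - G (INR q + 1).
  move=> hq; have := INR_leq hq; rewrite (@INR_eq_IZR 400 400) // => x4.
  (* The tangent of [ln] at 400, with [ln 400 / 400 < 3 / 200]. *)
  have lq : ln (INR q) <= (3 / 200) * INR q.
    have := @ln_le_sub1 (INR q / 400) ltac:(lra).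
    by rewrite ln_div; lra.
  have e : G (INR q) - G (INR q + 1) = (3 / 100) / ((INR q - 1) * (INR q - 2) * INR q).
    by rewrite /G; field; lra.
  rewrite e /u; case: ifP => _; last first.
    by apply: Rdiv_le_0_compat; [lra|]; apply: Rmult_lt_0_compat; nra.
  apply: Rle_trans (Rmult_le_compat_r _ _ _ (@rem_weight_ge0 q ltac:(lia)) lq) _.
  rewrite /rem_weight; move: x4; set x := INR q => x4.
  apply/Rminus_le_0.
  have -> : (3 / 100) / ((x - 1) * (x - 2) * x) -
    (3 / 200) * x * (2 * (x + 2) / ((x - 1) ^ 2 * (x + 1) * (x ^ 2 + x + 1)))
    = (3 / 100) * ((x - 1) * (x + 1) * (x ^ 2 + x + 1) - x ^ 2 * (x + 2) * (x - 2))
      / ((x - 1) ^ 2 * (x - 2) * x * (x + 1) * (x ^ 2 + x + 1)).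
    by field; repeat split; nra.
  apply: Rdiv_le_0_compat; first by nra.
  have x2 : 0 < x ^ 2 by apply: pow_lt; lra.
  by repeat apply: Rmult_lt_0_compat; try lra; apply: pow_lt; lra.
have tail d : \rsum_(N <= q < N + d) u q <= G (INR N) - G (INR (N + d)).
  elim: d => [|d IH]; first by rewrite addn0 big_geq //; lra.
  rewrite addnS big_nat_recr /=; last by rewrite leq_addr.
  by have := step _ (leq_trans hN (leq_addr d N)); rewrite S_INR; lra.
rewrite !uE; apply: Rle_trans (rsum_nat_le u0 (leq_addl N M)) _.
rewrite (@big_cat_nat _ _ _ N) //=; last by rewrite leq_addr.
apply: Rplus_le_compat_l; apply: Rle_trans (tail M) _.
have := INR_leq hN; rewrite (@INR_eq_IZR 400 400) // => N4.
have NM := INR_leq (leq_addr M N).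
have : 0 <= G (INR (N + M)) by rewrite /G; apply: Rdiv_le_0_compat; nra.
have : G (INR N) <= 3 / 200 / (399 * 398).
  by apply: Rmult_le_compat_l; [lra|]; apply: Rinv_le_contravar; nra.
lra.
Qed.

Lemma K_term_split (q : nat) : odd_prime q ->
  K_term q = ln (INR q) / (INR q ^ 2 - 1) + 2 * (ln (INR q) / (INR q ^ 3 - 1))
     + ln (INR q) * rem_weight q.
Proof.
move=> oq; have /andP[_ q2] := oq; have := INR_leq q2; rewrite INR_3 => q3.
rewrite /K_term oq /rem_weight; field; repeat split; nra.
Qed.

(** The prime sums include 2 while [K] does not, which explains [13/21 = 1/3 + 2/7]. *)
Lemma K_partial_split (M : nat) : (2 < M)%N ->
  \rsum_(0 <= q < M) K_term q
   = prime_log_sum 2 M + 2 * prime_log_sum 3 M - 13 / 21 * ln 2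
     + \rsum_(0 <= q < M | odd_prime q) (ln (INR q) * rem_weight q).
Proof.
case: M => [|[|[|M]]] // _; rewrite rsum_K_term.
rewrite (eq_bigr (fun q => ln (INR q) / (INR q ^ 2 - 1) + 2 * (ln (INR q) / (INR q ^ 3 - 1))
     + ln (INR q) * rem_weight q)); last first.
  by move=> q oq; rewrite -K_term_split // /K_term oq.
rewrite !big_split /= rsum_scal /prime_log_sum !big_prime_odd (_ : INR 2 = 2) //.
rewrite /pow; field.
Qed.

Lemma zeta2_sum_bounds :
  IZR 16424309392263 / 10 ^ 13 <= \rsum_(0 <= n < 400) zeta_term 2 n
   <= IZR 16424309392642 / 10 ^ 13.
Proof. apply: (@zeta_sum_fx 2 399); vm_cast_no_check (erefl true). Qed.

Lemma zeta3_sum_bounds :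
  IZR 12020537703187 / 10 ^ 13 <= \rsum_(0 <= n < 400) zeta_term 3 n
   <= IZR 12020537703570 / 10 ^ 13.
Proof. apply: (@zeta_sum_fx 3 399); vm_cast_no_check (erefl true). Qed.

Lemma log2_sum_bounds :
  IZR 9200508546508 / 10 ^ 13 <= \rsum_(0 <= n < 400) log_term 2 n
   <= IZR 9200508553499 / 10 ^ 13.
Proof. apply: (@log_sum_fx 2 398); vm_cast_no_check (erefl true). Qed.

Lemma log3_sum_bounds :
  IZR 1981059099704 / 10 ^ 13 <= \rsum_(0 <= n < 400) log_term 3 n
   <= IZR 1981059102173 / 10 ^ 13.
Proof. apply: (@log_sum_fx 3 398); vm_cast_no_check (erefl true). Qed.

Lemma rem_sum_bounds :
  IZR 633063690616 / 10 ^ 13 <= \rsum_(0 <= q < 400 | odd_prime q) (ln (INR q) * rem_weight q)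
   <= IZR 633063691248 / 10 ^ 13.
Proof. apply: (@rem_sum_fx 398); vm_cast_no_check (erefl true). Qed.

Lemma prime_log_sum_ge0 (s N : nat) : (0 < s)%N -> 0 <= prime_log_sum s N.
Proof.
move=> s0; apply: rsum_ge0 => q _ pq; apply: Rdiv_le_0_compat.
  exact/ln_INR_ge0/prime_gt0.
by have := prime_pow_gt1 s0 pq; lra.
Qed.

(** [K] is [- zeta'/zeta] at 2, plus twice that at 3, minus the share of the prime 2, plus the
    remainder sum. Summation below 400 with the Hermite-Hadamard tails places it between 0.5338215
    and 0.5338219. *)
Lemma K_bounds : 0.533821 < K < 0.533822.
Proof.
have [z2u z2l] := @zeta2_tail 400 isT; have [z3u z3l] := @zeta3_tail 400 isT.
have [a2u a2l] := @log2_tail 400 isT; have [a3u a3l] := @log3_tail 400 isT.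
have hz2 := zeta2_sum_bounds.
have hz3 := zeta3_sum_bounds.
have ha2 := log2_sum_bounds.
have ha3 := log3_sum_bounds.
have hr := rem_sum_bounds.
have hl := ln400_bounds.
have hl2 := @ln_fx_bounds 1 6931471795482 6931471805732 erefl.
rewrite (_ : INR 2 = 2) // in hl2.
rewrite (@INR_eq_IZR 400 400) // in z2u z2l z3u z3l a2u a2l a3u a3l.
have hlh : ln (400 - / 2) <= ln 400 - / 800.
  have := @ln_le_sub1 ((400 - / 2) / 400) ltac:(lra).
  by rewrite ln_div; lra.
have ez2 : ex_series (zeta_term 2) := ex_series_bounded (@zeta_term_ge0 2) z2u.
have ez3 : ex_series (zeta_term 3) := ex_series_bounded (@zeta_term_ge0 3) z3u.
pose Z2 := Series (zeta_term 2); pose Z3 := Series (zeta_term 3).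
have Z2u : Z2 <= 1.6424309392642 + / 399.5.
  by have := Series_le_bound (@zeta_term_ge0 2) z2u; rewrite -/Z2; lra.
have Z3u : Z3 <= 1.202053770357 + / 399.5 ^ 2 / 2.
  by have := Series_le_bound (@zeta_term_ge0 3) z3u; rewrite -/Z3; lra.
have Z2l : 1.6424309392263 + / 400 + / 400 ^ 2 / 2 <= Z2.
  apply: (@le_of_sqrt_decay _ _ 4 400); first lra.
  move=> M hM; apply: Rle_trans (rsum_le_Series (@zeta_term_ge0 2) M ez2).
  by have := z2l M hM; lra.
have Z3l : 1.2020537703187 + / 400 ^ 2 / 2 + / 400 ^ 3 / 2 <= Z3.
  apply: (@le_of_sqrt_decay _ _ 4 400); first lra.
  move=> M hM; apply: Rle_trans (rsum_le_Series (@zeta_term_ge0 3) M ez3).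
  by have := z3l M hM; lra.
have P2 M := @prime_log_sum_ge0 2 M isT; have P3 M := @prime_log_sum_ge0 3 M isT.
split.
  suff : 0.5338215 <= K by lra.
  (* [12 = 4 + 2 * 4] collects the decay terms of the two [log_term] sums, the second taken twice;
     dividing by the zeta values, which exceed 1, only lowers them. *)
  apply: (@le_of_sqrt_decay _ _ 12 400); first lra.
  move=> M hM; apply: Rle_trans (K_ge M); rewrite K_partial_split; last by apply: leq_trans hM.
  have r0 : \rsum_(0 <= q < 400 | odd_prime q) (ln (INR q) * rem_weight q)
     <= \rsum_(0 <= q < M | odd_prime q) (ln (INR q) * rem_weight q).
    rewrite big_mkcond [X in _ <= X]big_mkcond; apply: rsum_nat_le => // q.
    case: ifP => [/andP[/prime_gt1 q1 _]|_]; last lra.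
    by apply: Rmult_le_pos; [apply: ln_INR_ge0; lia | exact: rem_weight_ge0].
  (* With numbers in place of the zeta values, the goal is linear in the two prime sums. *)
  have := Rmult_le_compat_r _ _ _ (P2 M) Z2u; have := Rmult_le_compat_r _ _ _ (P3 M) Z3u.
  have := @prime_log_sum_ge 2 isT ez2 M; have := @prime_log_sum_ge 3 isT ez3 M.
  have := a2l M hM; have := a3l M hM; rewrite -/Z2 -/Z3 /(Rdiv 12) /(Rdiv 4 (sqrt _)).
  have : 0 <= / sqrt (INR M).
    have M0 : 0 < INR M by apply: INR_gt0; apply: leq_trans hM.
    by apply/Rlt_le/Rinv_0_lt_compat/sqrt_lt_R0.
  move: hr r0 ha2 ha3 hl hl2; clear; lra.
suff : K <= 0.5338219 by lra.
apply: (Series_le_bound K_term_ge0) => M.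
(* Adding 3 brings the prime 2 into the range, as [K_partial_split] requires. *)
apply: Rle_trans (rsum_nat_le K_term_ge0 (leq_addl 3 M)) _.
rewrite K_partial_split ?leq_addr //.
have := @rem_tail_le 400 (3 + M) isT.
have := Rmult_le_compat_r _ _ _ (P2 (3 + M)%N) Z2l; have := Rmult_le_compat_r _ _ _ (P3 (3 + M)%N) Z3l.
have := @prime_log_sum_le 2 isT ez2 _ (3 + M) a2u; have := @prime_log_sum_le 3 isT ez3 _ (3 + M) a3u.
rewrite -/Z2 -/Z3.
move: hr ha2 ha3 hl hl2 hlh; clear; lra.
Qed.

Theorem theorem1 (n : nat) (hn : (2 <= n)%N) :
  (0.533821 < K < 0.533822) /\
  (- (1 / 2) * sqrt (INR n) * ln (INR n) - 4 * sqrt (INR n)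
     - 7 * sqrt (INR n) / ln (INR n) - 5 / 4 * ln (INR n) + 1 / 2 * ln 2
     + ln (sqrt (2 * PI)) - K - 13 / 4 - 1 / ln (INR n)
     - ln (INR n) / (4 * sqrt (INR n)) - 1 / (4 * sqrt (INR n))
     + 1 / (12 * INR n + 1)
   <= ln (INR (G n)) - (INR n * ln (INR n) + INR n * (3 / 2 * ln 2 - 1 + K))
   <= 1 / 2 * sqrt (INR n) * ln (INR n) + 4 * sqrt (INR n)
     + 7 * sqrt (INR n) / ln (INR n) + 1 / 2 * ln (INR n) + 3
     + ln (sqrt (2 * PI)) - ln 2 - 0.1250281 + 1 / ln (INR n)
     + 1 / (12 * INR n)).
Proof.
have hK := K_bounds; split=> //.
by apply: ln_G_bounds => //; lra.
Qed.
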